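(* Let $N\ge2$ and let $\mu$ be the quasi-stationary Markov measure on $\mathcal K_N$ associated to $(\lambda,T)$. Then $\mu\circ\sigma_j^{-1}\ll\mu$ for all $j\in\mathbb Z_N$ and, for $\mu$-a.e. $x_1x_2\dots\in\mathcal K_N$, $$\frac{d(\mu\circ\sigma_j^{-1})}{d\mu}(x_1x_2\dots)=\delta_{j,x_1}\frac{\lambda_{x_2}}{\lambda_{x_1}T^{(1)}_{x_1,x_2}}F(x_2x_3\dots)=:f_j^2(x_1x_2\dots),\qquad f_j\ge0,$$ where $$F(x_1x_2\dots)=\prod_{n=1}^\infty\frac{T^{(n)}_{x_n,x_{n+1}}}{T^{(n+1)}_{x_n,x_{n+1}}}\quad\text{and}\quad 0<F(x_1x_2\dots)<\infty .$$ Also (with $\mu\circ\sigma^{-1}\ll\mu$), $$\frac{d(\mu\circ\sigma^{-1})}{d\mu}(x_1x_2\dots)=\frac1{F(x_1x_2\dots)}.$$ The operators $S_j$ on $L^2(\mu)$ defined by $$S_jf=f_j\,(f\circ\sigma)\qquad(f\in L^2(\mu),\ j\in\mathbb Z_N)$$ form a nonnegative monic representation of the Cuntz algebra $\mathcal O_N$.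
   Context: $\mathbb N=\{1,2,\dots\}$, $\mathbb Z_N=\{0,1,\dots,N-1\}$, and $\mathcal K_N=\mathbb Z_N^{\mathbb N}$ is the set of infinite words $x_1x_2\dots$ over $\mathbb Z_N$, with the product topology and Borel sigma-algebra. The shift is $\sigma(x_1x_2\dots)=x_2x_3\dots$ and its inverse branches are $\sigma_i(x_1x_2\dots)=ix_1x_2\dots$, $i\in\mathbb Z_N$. Here $\mu\circ\sigma_j^{-1}(A)=\mu(\sigma_j^{-1}(A))$ and $\mu\circ\sigma^{-1}(A)=\mu(\sigma^{-1}(A))$ for Borel $A$, with preimages. For a finite word $I=i_1\dots i_n$, the cylinder set is $\mathcal C(I)=\{x\in\mathcal K_N:x_1=i_1,\dots,x_n=i_n\}$. Markov measures: a matrix is stochastic if each row sums to $1$. Let $\lambda=(\lambda_0,\dots,\lambda_{N-1})$ be a row vector with $\lambda_i>0$ and $\sum_i\lambda_i=1$, and let $T=\{T^{(n)}\}_{n\in\mathbb N}$ be a sequence of stochastic $N\times N$ matrices with $T^{(n)}_{i,j}>0$ for all $i,j\in\mathbb Z_N$, $n\in\mathbb N$, and such that $\lambda T^{(1)}=\lambda$. The Markov measure associated to $(\lambda,T)$ is the unique Borel probability measure $\mu$ on $\mathcal K_N$ with $$\mu(\mathcal C(i_1\dots i_n))=\lambda_{i_1}T^{(1)}_{i_1,i_2}T^{(2)}_{i_2,i_3}\cdots T^{(n-1)}_{i_{n-1},i_n}$$ for all finite words. It is quasi-stationary if $$\sum_{n=1}^\infty\left|\frac{T^{(n)}_{x_n,x_{n+1}}}{T^{(n+1)}_{x_n,x_{n+1}}}-1\right|<\infty\quad\text{for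 all }x_1x_2\dots\in\mathcal K_N.$$ Cuntz algebra: $\mathcal O_N$ is the $C^*$-algebra generated by $N$ isometries $(S_i)_{i\in\mathbb Z_N}$ satisfying $S_i^*S_j=\delta_{ij}I$ and $\sum_{i\in\mathbb Z_N}S_iS_i^*=I$; a representation of $\mathcal O_N$ on a Hilbert space $\mathcal H$ is given by operators $S_i$ on $\mathcal H$ satisfying these relations. For $I=i_1\dots i_n$ put $S_I=S_{i_1}\cdots S_{i_n}$. The representation is monic if there is $\varphi\in\mathcal H$ such that the closed linear span of $\{S_IS_I^*\varphi: I\text{ a finite word}\}$ is $\mathcal H$. A monic system is a pair $(\mu,(f_i)_{i\in\mathbb Z_N})$ where $\mu$ is a finite Borel measure on $\mathcal K_N$, $\mu\circ\sigma_i^{-1}\ll\mu$, $d(\mu\circ\sigma_i^{-1})/d\mu=|f_i|^2$ with $f_i\in L^2(\mu)$, and $f_i(x)\ne0$ for $\mu$-a.e. $x\in\sigma_i(\mathcal K_N)$, for all $i\in\mathbb Z_N$. It is nonnegative if all $f_i\ge0$. Its associated representation is $S_if=f_i(f\circ\sigma)$ on $L^2(\mu)$; this representation is called nonnegative if the monic system is. *)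

(* Defs.v *)
From HB Require Import structures.
From mathcomp Require Import all_boot all_order all_algebra sesquilinear.
From mathcomp Require Import ring_quotient generic_quotient.
From mathcomp Require Import complex.
From mathcomp Require Import all_classical all_reals all_analysis.

Set Implicit Arguments.
Unset Strict Implicit.
Unset Printing Implicit Defensive.

Import Order.TTheory GRing.Theory Num.Theory numFieldNormedType.Exports.

Local Open Scope classical_set_scope.
Local Open Scope quotient_scope.
Local Open Scope charge_scope.
Local Open Scope ring_scope.

Local Notation Re := complex.Re.
Local Notation Im := complex.Im.

Section SquareIntegrable.
Context d (T : measurableType d) (R : realType) (mu : {measure set T -> \bar R}).

(* As |f|^2 = (Re f)^2 + (Im f)^2, a complex function is square-integrable iff
   its real and imaginary parts are in the real L^2. *)
Definition square_integrable : {pred T -> R[i]} :=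
  [pred f : T -> R[i] | (@Re R \o f \in Lfun mu 2%:E) && (@Im R \o f \in Lfun mu 2%:E)].

Lemma square_integrable_submod_closed : submod_closed square_integrable.
Proof.
have le12 : (1 <= 2%:E :> \bar R)%E by rewrite lee_fin ler1n.
have [L0 LD] := @Lfun_addr_closed _ _ _ mu _ le12.
have LZ h b : h \in Lfun mu 2%:E -> b \o* h \in Lfun mu 2%:E.
  by apply: Lfun_scale; rewrite ler1n.
split=> [|a f g /andP[fr fi] /andP[gr gi]]; rewrite inE; apply/andP; split=> //.
- have -> : @Re R \o (a *: f + g) =
      (Re a \o* (@Re R \o f)) + (- Im a \o* (@Im R \o f)) + (@Re R \o g).
    apply/funext => x; rewrite !fctE /=.
    by case: a (f x) (g x) => [p q] [? ?] [? ?] /=; rewrite mulrN (mulrC _ p) (mulrC _ q).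
  by apply/LD/gr; apply/LD; exact: LZ.
- have -> : @Im R \o (a *: f + g) =
      (Re a \o* (@Im R \o f)) + (Im a \o* (@Re R \o f)) + (@Im R \o g).
    apply/funext => x; rewrite !fctE /=.
    by case: a (f x) (g x) => [p q] [? ?] [? ?] /=; rewrite (mulrC _ p) (mulrC _ q).
  by apply/LD/gi; apply/LD; exact: LZ.
Qed.

HB.instance Definition _ := GRing.isSubmodClosed.Build R[i] (T -> R[i])
  square_integrable square_integrable_submod_closed.

Record L2fun := MkL2fun {
  L2fun_val :> T -> R[i] ;
  L2fun_proof : L2fun_val \in square_integrable }.

HB.instance Definition _ := [isSub for L2fun_val].
HB.instance Definition _ := [Choice of L2fun by <:].
HB.instance Definition _ := [SubChoice_isSubLmodule of L2fun by <:].

Definition L2null : {pred L2fun} :=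
  [pred f : L2fun | `[< {ae mu, forall x, f x = 0} >]].

Lemma L2null_zmod_closed : zmod_closed L2null.
Proof.
split=> [|f g /asboolP f0 /asboolP g0]; apply/asboolP; first exact: aeW.
near=> x; rewrite /= !fctE/= (near f0 x)// (near g0 x)// subrr.
Unshelve. all: by end_near. Qed.

HB.instance Definition _ := GRing.isZmodClosed.Build L2fun
  L2null L2null_zmod_closed.

(* The complex Hilbert space L^2(mu): square-integrable functions modulo almost
   everywhere equality (see L2classP), with the inner product L2dot, which is
   linear in its first argument. *)
Definition L2 : Type := Quotient.quot L2null.
HB.instance Definition _ := GRing.Zmodule.on L2.

Implicit Types (f g : L2fun) (u v w : L2) (a b : R[i]).

Definition L2class f : L2 := \pi_(Quotient.quot L2null) f.
Definition L2repr u : L2fun := repr (u : Quotient.quot L2null).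

Lemma L2reprK u : L2class (L2repr u) = u. Proof. exact: reprK. Qed.


Lemma L2classP f g :
  L2class f = L2class g <-> {ae mu, forall x, f x = g x}.
Proof.
split=> [/eqP|fg].
  rewrite -Quotient.idealrBE => /asboolP; apply: filterS => x /=.
  by rewrite !fctE /= => /eqP; rewrite subr_eq0 => /eqP.
apply/eqP; rewrite -Quotient.idealrBE; apply/asboolP; apply: filterS fg => x /=.
by rewrite !fctE /= => ->; rewrite subrr.
Qed.

Lemma L2reprE f : {ae mu, forall x, L2repr (L2class f) x = f x}.
Proof. by apply/L2classP; rewrite L2reprK. Qed.

Lemma L2classD : {morph L2class : f g / f + g}.
Proof. by move=> f g; rewrite /L2class raddfD. Qed.

Definition L2scale a u : L2 := L2class (a *: L2repr u).

Lemma L2scale_class a f : L2scale a (L2class f) = L2class (a *: f).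
Proof.
by apply/L2classP; apply: filterS (L2reprE f) => x /= fx; rewrite !fctE fx.
Qed.

Lemma L2scaleA a b u : L2scale a (L2scale b u) = L2scale (a * b) u.
Proof. by rewrite -[u]L2reprK !L2scale_class scalerA. Qed.

Lemma L2scale1 : left_id 1 L2scale.
Proof. by move=> u; rewrite -[u]L2reprK !L2scale_class scale1r. Qed.

Lemma L2scaleDr : right_distributive L2scale +%R.
Proof.
move=> a u v; rewrite -[u]L2reprK -[v]L2reprK -L2classD !L2scale_class.
by rewrite -L2classD scalerDr.
Qed.

Lemma L2scaleDl u : {morph L2scale^~ u : a b / a + b}.
Proof.
by move=> a b; rewrite -[u]L2reprK !L2scale_class -L2classD scalerDl.
Qed.

HB.instance Definition _ := GRing.Zmodule_isLmodule.Build R[i] L2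
  L2scaleA L2scale1 L2scaleDr L2scaleDl.

Lemma L2classZ a f : L2class (a *: f) = a *: L2class f.
Proof. by rewrite -L2scale_class. Qed.


Definition Cintegral (h : T -> R[i]) : R[i] :=
  Complex (\int[mu]_x Re (h x)) (\int[mu]_x Im (h x)).

Definition Cintegrable (h : T -> R[i]) : Prop :=
  mu.-integrable setT (EFin \o (@Re R \o h)) /\
  mu.-integrable setT (EFin \o (@Im R \o h)).

Lemma Cintegral_linear a (h k : T -> R[i]) : Cintegrable h -> Cintegrable k ->
  Cintegral (a *: h + k) = a * Cintegral h + Cintegral k.
Proof.
move=> [hr hi] [kr ki].
have Z (l : T -> R) c : mu.-integrable setT (EFin \o l) ->
    mu.-integrable setT (EFin \o (fun x => c * l x)) /\
    \int[mu]_x (c * l x) = c * \int[mu]_x l x.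
  move=> il; split; last by rewrite RintegralZl.
  by rewrite (_ : _ \o _ = fun x => c%:E * (EFin \o l) x)%E//; exact: integrableZl.
have D (l m : T -> R) : mu.-integrable setT (EFin \o l) ->
    mu.-integrable setT (EFin \o m) ->
    mu.-integrable setT (EFin \o (fun x => l x + m x)) /\
    \int[mu]_x (l x + m x) = \int[mu]_x l x + \int[mu]_x m x.
  move=> il im; split; last by rewrite RintegralD.
  rewrite (_ : _ \o _ = (EFin \o l) \+ (EFin \o m))%E//; exact: integrableD.
have L p q (l m n : T -> R) : mu.-integrable setT (EFin \o l) ->
    mu.-integrable setT (EFin \o m) -> mu.-integrable setT (EFin \o n) ->
    \int[mu]_x (p * l x + q * m x + n x) =
    p * \int[mu]_x l x + q * \int[mu]_x m x + \int[mu]_x n x.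
  move=> il im i_n; have [il' <-] := Z l p il; have [im' <-] := Z m q im.
  by have [i1 <-] := D _ _ il' im'; have [_ <-] := D _ _ i1 i_n.
case: a => p q; rewrite /Cintegral /=.
apply/eqP; rewrite eq_complex /=; apply/andP; split; apply/eqP.
- rewrite -mulNr -(L p (- q) _ _ _ hr hi kr); apply: eq_Rintegral => x _.
  by rewrite !fctE /=; case: (h x) (k x) => [? ?] [? ?] /=; rewrite mulNr.
- rewrite -(L p q _ _ _ hi hr ki); apply: eq_Rintegral => x _.
  by rewrite !fctE /=; case: (h x) (k x) => [? ?] [? ?] /=.
Qed.

Lemma ae_eq_Cintegral (h k : T -> R[i]) : Cintegrable h -> Cintegrable k ->
  {ae mu, forall x, h x = k x} -> Cintegral h = Cintegral k.
Proof.
move=> [hr hi] [kr ki] hk; rewrite /Cintegral /Rintegral; congr (Complex (fine _) (fine _)).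
- apply: ae_eq_integral => //; [exact: measurable_int hr|exact: measurable_int kr|].
  by apply: filterS hk => x /= ->.
- apply: ae_eq_integral => //; [exact: measurable_int hi|exact: measurable_int ki|].
  by apply: filterS hk => x /= ->.
Qed.

Lemma Cintegral_conj (h : T -> R[i]) : Cintegrable h ->
  Cintegral (fun x => (h x)^*) = (Cintegral h)^*.
Proof.
move=> [hr hi]; rewrite /Cintegral /=; congr Complex.
- by apply: eq_Rintegral => x _; case: (h x).
- rewrite -[RHS]mulN1r -RintegralZl//; apply: eq_Rintegral => x _.
  by rewrite mulN1r; case: (h x).
Qed.

Definition L2inner f g : R[i] := Cintegral (fun x => f x * (g x)^*).

Lemma L2inner_integrable f g : Cintegrable (fun x => f x * (g x)^*).
Proof.
have /andP[fr fi] := L2fun_proof f; have /andP[gr gi] := L2fun_proof g.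
have B (h k : T -> R) : h \in Lfun mu 1 -> k \in Lfun mu 1 -> h - k \in Lfun mu 1.
  by move=> hL kL; apply: (@Lfun_addr_closed _ _ _ mu 1%E (lexx _)).2 => //;
     exact: (@Lfun_oppr_closed _ _ _ mu 1%E).
have D (h k : T -> R) : h \in Lfun mu 1 -> k \in Lfun mu 1 -> h \+ k \in Lfun mu 1.
  by have [_] := @Lfun_addr_closed _ _ _ mu 1%E (lexx _); apply.
split; apply/Lfun1_integrable.
- rewrite (_ : _ \o _ = ((@Re R \o f) \* (@Re R \o g)) \+ ((@Im R \o f) \* (@Im R \o g))).
    by apply: D; exact: Lfun2_mul_Lfun1.
  by apply/funext => x /=; case: (f x) (g x) => [? ?] [? ?] /=; rewrite mulrN opprK.
- rewrite (_ : _ \o _ = ((@Im R \o f) \* (@Re R \o g)) - ((@Re R \o f) \* (@Im R \o g))).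
    by apply: B; exact: Lfun2_mul_Lfun1.
  apply/funext => x; rewrite !fctE /=.
  by case: (f x) (g x) => [? ?] [? ?] /=; rewrite mulrN addrC.
Qed.

Definition L2dot u v : R[i] := L2inner (L2repr u) (L2repr v).

Lemma L2dot_class f g : L2dot (L2class f) (L2class g) = L2inner f g.
Proof.
apply: ae_eq_Cintegral; [exact: L2inner_integrable..|].
by near=> x; rewrite (near (L2reprE f) x)// (near (L2reprE g) x).
Unshelve. all: by end_near. Qed.

Lemma L2dotC u v : L2dot u v = (-1) ^+ false * (L2dot v u)^*.
Proof.
rewrite expr0 mul1r -[RHS]Cintegral_conj; last exact: L2inner_integrable.
congr Cintegral; apply/funext => x; rewrite rmorphM /= conjCK mulrC.
by [].
Qed.

Lemma L2dot_linearl v : linear_for *%R (L2dot^~ v).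
Proof.
move=> a u w; rewrite -[u]L2reprK -[v]L2reprK -[w]L2reprK.
rewrite -L2classZ -L2classD !L2dot_class -Cintegral_linear; last 2 first.
- exact: L2inner_integrable.
- exact: L2inner_integrable.
congr Cintegral; apply/funext => x; rewrite !fctE /= !fctE.
by rewrite mulrDl -scalerAl.
Qed.

Lemma L2dot_bilinear : bilinear_for ( *%R ) (Num.conj \; *%R ) L2dot.
Proof.
split=> [v|u a v w]; first exact: L2dot_linearl.
rewrite L2dotC L2dot_linearl expr0 mul1r rmorphD rmorphM /=.
by rewrite [L2dot u v]L2dotC [L2dot u w]L2dotC !expr0 !mul1r.
Qed.

HB.instance Definition _ :=
  bilinear_isBilinear.Build R[i] L2 L2 R[i] ( *%R ) (Num.conj \; *%R )
    L2dot L2dot_bilinear.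
HB.instance Definition _ :=
  isHermitianSesquilinear.Build R[i] L2 false Num.conj L2dot L2dotC.

Lemma L2dot_gt0 u : u != 0 -> 0 < L2dot u u.
Proof.
rewrite -[u]L2reprK L2dot_class; move: (L2repr u) => {u} f f0.
have [ir ii] := L2inner_integrable f f.
have fE x : f x * (f x)^* = (Re (f x) ^+ 2 + Im (f x) ^+ 2)%:C%C.
  by case: (f x) => p q; apply/eqP; rewrite eq_complex /=; apply/andP; split;
    rewrite ?mulrN ?opprK -?expr2// (mulrC q) addNr.
have q0 x : 0 <= Re (f x) ^+ 2 + Im (f x) ^+ 2 by rewrite addr_ge0 ?sqr_ge0.
have -> : L2inner f f = (\int[mu]_x (Re (f x) ^+ 2 + Im (f x) ^+ 2))%:C%C.
  rewrite /L2inner /Cintegral; congr Complex.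
    by apply: eq_Rintegral => x _; rewrite fE.
  by under eq_Rintegral do rewrite fE /=; rewrite /Rintegral integral0.
rewrite ltcR lt_neqAle Rintegral_ge0// andbT; apply: contra_neq f0 => f0.
have iq : mu.-integrable setT (fun x => (Re (f x) ^+ 2 + Im (f x) ^+ 2)%:E).
  by move: ir; congr (mu.-integrable _ _); apply/funext => x /=; rewrite fE.
have : (\int[mu]_x (Re (f x) ^+ 2 + Im (f x) ^+ 2)%:E = 0)%E.
  rewrite -[LHS]fineK; last exact: integrable_fin_num.
  by congr (_%:E); exact/esym/f0.
rewrite (eq_integral (fun x => `|(Re (f x) ^+ 2 + Im (f x) ^+ 2)%:E|%E)); last first.
  by move=> x _; rewrite gee0_abs// lee_fin.
move/(ae_eq_integral_abs mu measurableT (measurable_int _ iq)) => qae.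
have -> : (0 : L2) = L2class 0 by rewrite /L2class raddf0.
apply/L2classP; apply: filterS qae => x /(_ Logic.I) [/eqP].
rewrite paddr_eq0 ?sqr_ge0// !sqrf_eq0 => /andP[/eqP p0 /eqP q'0].
by case: (f x) p0 q'0 => p q /= -> ->.
Qed.

HB.instance Definition _ := isDotProduct.Build R[i] L2 L2dot L2dot_gt0.

End SquareIntegrable.

Section ImageMeasure.
Context d d' (T : measurableType d) (T' : measurableType d') (R : realType).
Variables (mu : {finite_measure set T -> \bar R}) (g : {mfun T >-> T'}).

Definition image_measure : set T' -> \bar R := pushforward mu g.

Let image_measure0 : image_measure set0 = 0%E.
Proof. exact: measure0. Qed.

Let image_measure_ge0 A : (0 <= image_measure A)%E.
Proof. exact: measure_ge0. Qed.

Let image_measure_sigma_additive : semi_sigma_additive image_measure.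
Proof. exact: measure_semi_sigma_additive. Qed.

HB.instance Definition _ := isMeasure.Build _ _ _ image_measure
  image_measure0 image_measure_ge0 image_measure_sigma_additive.

Let image_measure_finite : fin_num_fun image_measure.
Proof.
move=> A mA; apply: fin_num_measure.
by rewrite -[X in measurable X]setTI; exact: measurable_funP.
Qed.

HB.instance Definition _ := Measure_isFinite.Build _ _ _ image_measure
  image_measure_finite.

End ImageMeasure.

Section CuntzRepresentations.
Context (C : numClosedFieldType) (H : lmodType C) (ip : {dot H for Num.conj}).
Variable n : nat.
Implicit Types (A B : H -> H) (S : 'I_n -> H -> H) (I : seq 'I_n).

Definition hnorm (u : H) : C := sqrtC (ip u u).

Definition bounded_operator A : Prop :=
  linear A /\ exists M : C, forall u, hnorm (A u) <= M * hnorm u.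

Definition is_adjoint A B : Prop := forall u v, ip (A u) v = ip u (B v).

(* Meaningful when A has an adjoint, which is then unique because ip is
   definite. *)
Definition adjoint A (v : H) : H :=
  xget 0 [set w | forall u, ip (A u) v = ip u w].

(* The existence of adjoints is automatic for bounded operators when H is
   complete; H is not assumed complete here, so it is required explicitly. *)
Record cuntz_representation S : Prop := {
  cuntz_bounded : forall i, bounded_operator (S i) ;
  cuntz_adjointable : forall i, exists B, is_adjoint (S i) B ;
  cuntz_orthogonal : forall i j u,
    adjoint (S i) (S j u) = (i == j)%:R *: u ;
  cuntz_sum : forall u, \sum_i S i (adjoint (S i) u) = u }.

Definition closed_span (X : set H) : set H :=
  [set u | forall eps : C, 0 < eps -> exists s : seq (C * H),
    (forall p, p \in s -> X p.2) /\
    hnorm (u - \sum_(p <- s) p.1 *: p.2) < eps].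

(* For I = [:: i1; ..; ik] this is S i1 \o .. \o S ik. *)
Definition word_operator S I (u : H) : H := foldr S u I.

Definition monic_representation S : Prop := exists phi : H,
  closed_span
    [set word_operator S I (adjoint (word_operator S I) phi)
       | I in [set: seq 'I_n]] = [set: H].

End CuntzRepresentations.

Lemma prod_continuous (X : topologicalType) (I : eqType)
    (K : I -> topologicalType) (f : X -> prod_topology K) :
  (forall i, continuous (fun x => f x i)) -> continuous f.
Proof.
move=> cf x; apply/cvg_sup => i U [V /= [[W oW <-]]] WfN WU.
apply: (filterS WU); apply: (cf i x); exact: open_nbhs_nbhs.
Qed.

Lemma open_prod_proj (I : eqType) (K : I -> topologicalType) (i : I)
    (A : set (K i)) :
  open A -> open [set x : prod_topology K | A (x i)].
Proof. by move=> oA; apply: (open_comp _ oA) => x _; exact: proj_continuous. Qed.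

Section Words.
Variable n : nat.

(* The alphabet is Z_N with N = n.+1. Letters are indexed from 0: the letter
   x_k of the infinite word x_1 x_2 ... is x k.-1. *)
Definition word_space :=
  prod_topology (fun _ : nat => discrete_topology 'I_n.+1).
HB.instance Definition _ := Topological.on word_space.
HB.instance Definition _ := isPointed.Build word_space (fun=> ord0).

(* K_N with its Borel sigma-algebra. *)
Definition words : Type := g_sigma_algebraType (@open word_space).
HB.instance Definition _ :=
  Measurable.copy words (g_sigma_algebraType (@open word_space)).

Definition letter (x : words) (k : nat) : 'I_n.+1 := x k.
Coercion letter : words >-> Funclass.

Definition word_shift (x : words) : words := fun k => x k.+1.

Definition word_branch (i : 'I_n.+1) (x : words) : words :=
  fun k => if k is k'.+1 then x k' else i.

Definition cylinder (I : seq 'I_n.+1) : set words :=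
  [set x | mkseq x (size I) = I].

Lemma letterwise_measurable (f : words -> words)
    (g : nat -> 'I_n.+1 -> 'I_n.+1) (h : nat -> nat) :
  (forall x k, f x k = g k (x (h k))) -> measurable_fun setT f.
Proof.
move=> fE; apply: (@measurability _ _ words words setT f (@open word_space)).
  by [].
move=> _ [B oB <-]; rewrite setTI; apply: sub_sigma_algebra.
suff /continuousP cf : continuous (f : word_space -> word_space) by exact: cf.
apply: prod_continuous => k; apply/continuousP => A _.
rewrite (_ : _ @^-1` _ = [set x : word_space | (g k @^-1` A) (x (h k))]).
  apply: (@open_prod_proj nat (fun=> discrete_topology 'I_n.+1)).
  exact: discrete_open.
by apply/seteqP; split=> y /=; rewrite fE.
Qed.

Lemma measurable_shift : measurable_fun setT word_shift.
Proof. exact: (@letterwise_measurable _ (fun=> id) S). Qed.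

Lemma measurable_branch i : measurable_fun setT (word_branch i).
Proof.
apply: (@letterwise_measurable _ (fun k => if k is _.+1 then id else fun=> i)
  predn).
by move=> x [|k].
Qed.

HB.instance Definition _ :=
  isMeasurableFun.Build _ _ _ _ word_shift measurable_shift.
HB.instance Definition _ i :=
  isMeasurableFun.Build _ _ _ _ (word_branch i) (measurable_branch i).

End Words.

Section MonicSystems.
Context (R : realType) (n : nat) (mu : {finite_measure set (words n) -> \bar R}).
Implicit Types (f : 'I_n.+1 -> words n -> R[i]).

Record monic_system f : Prop := {
  monic_square_integrable : forall i, f i \in square_integrable mu ;
  monic_dominated : forall i, image_measure mu (word_branch i) `<< mu ;
  monic_derivative : forall i, {ae mu, forall x,
    ('d (image_measure mu (word_branch i)) '/d mu) x =
      (Re `|f i x| ^+ 2)%:E} ;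
  monic_neq0 : forall i,
    {ae mu, forall x, range (word_branch i) x -> f i x != 0} }.

Definition nonnegative_system f : Prop :=
  forall i, {ae mu, forall x, 0 <= f i x}.

(* S_i g = f_i (g \o word_shift), for every representative g of every class of
   L^2(mu). *)
Definition associated_representation f (S : 'I_n.+1 -> L2 mu -> L2 mu) : Prop :=
  forall i (g : L2fun mu),
    {ae mu, forall x, L2repr (S i (L2class g)) x = f i x * g (word_shift x)}.

End MonicSystems.

Section MarkovMeasures.
Context (R : realType) (n : nat).
Implicit Types (lam : 'rV[R]_n.+1) (T : nat -> 'M[R]_n.+1) (x : words n).

Definition stochastic (A : 'M[R]_n.+1) : Prop := forall i, \sum_j A i j = 1.

(* The matrix T^(k) of the sequence (T^(1), T^(2), ...) is T k.-1. *)
Definition is_markov_measure lam T (mu : probability (words n) R) : Prop :=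
  forall (i : 'I_n.+1) (I : seq 'I_n.+1),
    mu (cylinder (i :: I)) =
    (lam 0 i * \prod_(k < size I) T k (nth i (i :: I) k) (nth i (i :: I) k.+1))%:E.

Definition transition_ratio T x (k : nat) : R :=
  T k (x k) (x k.+1) / T k.+1 (x k) (x k.+1).

Definition quasi_stationary T : Prop :=
  forall x, (\sum_(0 <= k <oo) `|transition_ratio T x k - 1|%:E < +oo)%E.

Definition ratio_product T x : R^nat :=
  fun m => \prod_(k < m) transition_ratio T x k.

Definition markov_F T x : R := limn (ratio_product T x).

Definition markov_density lam T (j : 'I_n.+1) x : R :=
  (j == x 0%N)%:R * (lam 0 (x 1%N) / (lam 0 (x 0%N) * T 0%N (x 0%N) (x 1%N))) *
  markov_F T (word_shift x).

Definition markov_f lam T j x : R := Num.sqrt (markov_density lam T j x).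

End MarkovMeasures.

(* Main.v *)
Require Import Defs.
From HB Require Import structures.
From mathcomp Require Import all_boot all_order all_algebra sesquilinear.
From mathcomp Require Import complex.
From mathcomp Require Import ring lra.
From mathcomp Require Import all_classical all_reals all_analysis measurable_realfun.

Set Implicit Arguments.
Unset Strict Implicit.
Unset Printing Implicit Defensive.

Import Order.TTheory GRing.Theory Num.Theory numFieldNormedType.Exports.

Local Open Scope classical_set_scope.
Local Open Scope charge_scope.
Local Open Scope ring_scope.

(* Quasi-stationarity holds along every word, in particular along ijij... and
   jiji..., so the series of |ln (T^(n)_ij / T^(n+1)_ij)| converges for all i, j.
   Hence the partial products of F lie in a fixed interval [1/C, C], and converge.

   On cylinders of length m + 2 the measure of the preimage under word_branch j
   is exactly the measure of the cylinder times the formula of the density with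
   F replaced by its m-th partial product, by telescoping. Dominated convergence
   gives the density on all cylinders, and these form a pi-system generating
   the Borel sets. The shift is treated in the same way, with the reciprocal
   products and the stationarity of lambda.

   With dens_j = f_j^2, the change of variables
   int h(jx) dmu(x) = int h dens_j dmu shows that S_j is an isometry with adjoint
   S_j^* h(x) = h(jx) / f_j(jx). The Cuntz relations are then pointwise
   identities, and S_I S_I^* is multiplication by the indicator of the cylinder
   of I, so the constant function 1 is a cyclic vector. *)

(** * Cylinder sets as a generating pi-system *)

Lemma take_mkseq (T : Type) (f : nat -> T) m k :
  (m <= k)%N -> take m (mkseq f k) = mkseq f m.
Proof. by move=> mk; rewrite /mkseq -map_take take_iota (minn_idPl mk). Qed.

Section Cylinders.
Variable n : nat.
Implicit Types (x : words n) (I J : seq 'I_n.+1).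

Lemma cylinderP I x : cylinder I x <-> forall k, (k < size I)%N -> x k = nth ord0 I k.
Proof.
rewrite /cylinder /=; split=> [xI k kI|xI]; first by rewrite -xI nth_mkseq.
apply: (@eq_from_nth _ ord0); rewrite size_mkseq// => k kI.
by rewrite nth_mkseq// xI.
Qed.

Lemma cylinder_nil : cylinder [::] = [set: words n].
Proof. by apply/seteqP; split=> x _ //; apply/cylinderP. Qed.

Lemma cylinder_rcons I i :
  cylinder (rcons I i) = cylinder I `&` [set x : words n | x (size I) = i].
Proof.
apply/seteqP; split=> x.
- by rewrite /cylinder /= size_rcons mkseqS => /eqP; rewrite eqseq_rcons => /andP[/eqP ? /eqP].
- by rewrite /cylinder /= size_rcons mkseqS => -[-> ->].
Qed.

Lemma cylinder_cons i I :
  cylinder (i :: I) = [set x : words n | x 0%N = i] `&` @word_shift n @^-1` cylinder I.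
Proof.
apply/seteqP; split=> x /=.
- move=> /cylinderP xI; split; first exact: (xI 0%N).
  by apply/cylinderP => k kI; exact: (xI k.+1).
- by move=> [xi /cylinderP xI]; apply/cylinderP => -[|k] //; exact: xI.
Qed.

Lemma measurable_letter (k : nat) (A : set 'I_n.+1) :
  measurable [set x : words n | A (x k)].
Proof.
apply: sub_sigma_algebra.
apply: (@open_prod_proj nat (fun=> discrete_topology 'I_n.+1)).
exact: discrete_open.
Qed.

Lemma measurable_cylinder I : measurable (cylinder I).
Proof.
elim/last_ind: I => [|I i IH]; first by rewrite cylinder_nil; exact: measurableT.
by rewrite cylinder_rcons; apply: measurableI => //; exact: (measurable_letter _ [set i]).
Qed.

Lemma cylinder_mkseq x m : cylinder (mkseq x m) x.
Proof. by rewrite /cylinder /= size_mkseq. Qed.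

(** The cylinders around [x] form a filter base. Its filter converges to [x] in the product topology
    because it does so in each coordinate: fixing [k.+1] letters fixes the letter of index [k]. *)
Lemma open_cylinder_sub (U : set (word_space n)) x : open U -> U x ->
  exists m, cylinder (mkseq x m) `<=` (U : set (words n)).
Proof.
move=> oU Ux.
pose F := filter_from [set: nat] (fun m => cylinder (mkseq x m)).
have FF : Filter F.
  apply: filter_from_filter; first by exists 0%N.
  move=> i j _ _; exists (maxn i j) => // y /cylinderP; rewrite size_mkseq => xy.
  have sub m : (m <= maxn i j)%N -> cylinder (mkseq x m) y.
    move=> mij; apply/cylinderP => k; rewrite size_mkseq => km.
    have kij := leq_trans km mij.
    by rewrite xy ?kij// !nth_mkseq.
  by split; apply: sub; rewrite ?leq_maxl ?leq_maxr.
suff : (F : set_system (word_space n)) --> (x : word_space n).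
  move=> /(_ U) [|m _ mU]; first exact: open_nbhs_nbhs.
  by exists m.
apply/cvg_sup => k V [/= W [[A oA <-] Ax] WV].
exists k.+1 => // y /cylinderP; rewrite size_mkseq => /(_ k (ltnSn k)).
by rewrite nth_mkseq// => xy; apply: WV => /=; rewrite [y k]xy.
Qed.

Lemma cylinderI I J : (size I <= size J)%N ->
  cylinder I `&` cylinder J = if take (size I) J == I then cylinder J else set0.
Proof.
move=> IJ; case: eqP => TJ; apply/seteqP; split=> x //.
- by case.
- by move=> xJ; split=> //; rewrite /cylinder /= -(take_mkseq x IJ) xJ.
- by move=> [xI xJ]; apply: TJ; rewrite -xJ (take_mkseq x IJ).
Qed.

(** The empty set is included because two cylinders of incompatible words are disjoint; with it the
    family is closed under intersection. *)
Definition cylinders : set (set (words n)) := [set A | A = set0 \/ exists I, A = cylinder I].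

Lemma cylinders_setI : setI_closed cylinders.
Proof.
move=> _ _ [->|[I ->]] [->|[J ->]]; rewrite ?set0I ?setI0; try by left.
have [IJ|/ltnW JI] := leqP (size I) (size J).
  by rewrite cylinderI//; case: ifP => _; [right; exists J|left].
by rewrite setIC cylinderI//; case: ifP => _; [right; exists I|left].
Qed.

(** An open set is the union of the cylinders that it contains, and there are only countably many
    finite words. *)
Lemma measurable_cylindersE : @measurable _ (words n) = <<s cylinders >>.
Proof.
apply/seteqP; split; last first.
  apply: smallest_sub; first exact: sigma_algebra_measurable.
  by move=> _ [->|[I ->]]; [exact: measurable0|exact: measurable_cylinder].
apply: smallest_sub; first exact: smallest_sigma_algebra.
move=> U oU.
have -> : U = \bigcup_(I in [set I | cylinder I `<=` U]) cylinder I.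
  apply/seteqP; split=> x /=; last by move=> [I IU]; exact: IU.
  move=> Ux; have [m mU] := open_cylinder_sub oU Ux.
  by exists (mkseq x m) => //; exact: cylinder_mkseq.
pose M := g_sigma_algebraType cylinders.
suff : @measurable _ M (\bigcup_(I in [set I | cylinder I `<=` U]) cylinder I) by [].
rewrite bigcup_mkcond; apply: countable_bigcupT_measurable => [|I].
  exact: countableP.
case: ifPn => _; last exact: (@measurable0 _ M).
by apply: sub_gen_smallest; right; exists I.
Qed.

(** Dynkin's pi-lambda argument. The whole space is the cylinder of the empty word, and the empty
    set is its complement. *)
Lemma cylinder_induction (P : set_system (words n)) :
  (forall I, P (cylinder I)) ->
  (forall A, measurable A -> P A -> P (~` A)) ->
  (forall F : (set (words n))^nat, (forall k, measurable (F k)) ->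
    trivIset setT F -> (forall k, P (F k)) -> P (\bigcup_k F k)) ->
  forall A, measurable A -> P A.
Proof.
move=> Pc PC PU A; rewrite measurable_cylindersE.
have PT : P setT by rewrite -cylinder_nil.
apply: dynkin_induction => //; first exact: measurable_cylindersE.
  exact: cylinders_setI.
move=> _ [->|[I ->]] //; rewrite -setCT; apply: PC => //; exact: measurableT.
Qed.

(** Every preimage is a union of cylinders of length [m], of which there are countably many. *)
Lemma measurable_fun_prefix d (S : measurableType d) (g : seq 'I_n.+1 -> S) m :
  measurable_fun setT (fun x : words n => g (mkseq x m)).
Proof.
move=> _ B mB; rewrite setTI.
have -> : (fun x : words n => g (mkseq x m)) @^-1` B =
    \bigcup_(I in [set I | B (g I) /\ size I = m]) cylinder I.
  apply/seteqP; split=> x.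
    move=> Bx; exists (mkseq x m); last exact: cylinder_mkseq.
    by rewrite /= size_mkseq.
  by move=> [I [BI Im]]; rewrite /cylinder /= Im => ->.
rewrite bigcup_mkcond; apply: countable_bigcupT_measurable => [|I].
  exact: countableP.
by case: ifPn => _; [exact: measurable_cylinder|exact: measurable0].
Qed.

Lemma branchK i : cancel (@word_branch n i) (@word_shift n).
Proof. by move=> x; apply/funext => k. Qed.

Lemma shiftK i x : x 0%N = i -> word_branch i (word_shift x) = x.
Proof. by move=> <-; apply/funext; case. Qed.

Lemma range_branch i : range (@word_branch n i) = [set x : words n | x 0%N = i].
Proof.
by apply/seteqP; split=> [_ [x _ <-]//|x xi]; exists (word_shift x) => //; exact: shiftK.
Qed.

Lemma preimage_branch_cylinder i j I : @word_branch n j @^-1` cylinder (i :: I) =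
  if i == j then cylinder I else set0.
Proof.
rewrite cylinder_cons preimage_setI -comp_preimage.
rewrite (_ : _ \o _ = id) ?preimage_id; last by apply/funext => x; exact: branchK.
case: eqVneq => [->|ij]; apply/seteqP; split=> x //=; first by case.
by move=> [ji _]; rewrite ji eqxx in ij.
Qed.

Lemma preimage_shift_cylinder I :
  @word_shift n @^-1` cylinder I = \big[setU/set0]_i cylinder (i :: I).
Proof.
rewrite -bigcup_seq; apply/seteqP; split=> x /=.
  by move=> xI; exists (x 0%N); [rewrite /= mem_index_enum|rewrite cylinder_cons].
by move=> [i _]; rewrite cylinder_cons => -[].
Qed.

Lemma cylinder_split I : cylinder I = \big[setU/set0]_i cylinder (rcons I i).
Proof.
rewrite -bigcup_seq; apply/seteqP; split=> x /=.
  by move=> xI; exists (x (size I)); [rewrite /= mem_index_enum|rewrite cylinder_rcons].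
by move=> [i _]; rewrite cylinder_rcons => -[].
Qed.

End Cylinders.

(** * Partial products of F *)

Section RatioProduct.
Context (R : realType) (n : nat) (T : nat -> 'M[R]_n.+1).
Hypothesis T_gt0 : forall k i j, 0 < T k i j.
Hypothesis T_qs : quasi_stationary T.
Implicit Types (x : words n) (u : R^nat).

Let bounded_sums u := exists C, forall m, \sum_(k < m) u k <= C.

(** Both sides come from [ln s <= s - 1], taken at [r] and at [r^-1]; the factor 2 bounds [r^-1]. *)
Lemma abs_ln_le (r : R) : 2^-1 <= r -> `|ln r| <= 2 * `|r - 1|.
Proof.
move=> r2; have r0 : 0 < r by apply: lt_le_trans r2.
have lnE (s : R) : 0 < s -> ln s <= s - 1.
  move=> s0; rewrite -{1}(subrK 1 s) addrC le_ln1Dx//.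
  by rewrite ltrBrDr addrC subrr.
rewrite ler_norml; apply/andP; split.
  rewrite lerNl -lnV ?posrE// (le_trans (lnE _ _)) ?invr_gt0//.
  have -> : r^-1 - 1 = r^-1 * (1 - r) by rewrite mulrBr mulr1 mulVf ?gt_eqF.
  rewrite distrC; apply: (le_trans (ler_norm _)).
  rewrite normrM ler_wpM2r// gtr0_norm ?invr_gt0//.
  by rewrite -[leRHS]invrK lef_pV2 ?posrE// invr_gt0.
apply: (le_trans (lnE _ r0)); apply: (le_trans (ler_norm _)).
by rewrite ler_peMl// ler1n.
Qed.

Lemma transition_ratio_gt0 x k : 0 < transition_ratio T x k.
Proof. by rewrite divr_gt0. Qed.

(** The terms of a convergent series tend to 0, so from some rank [K] on the ratios are at least 1/2
    and [abs_ln_le] applies. The earlier terms contribute a finite sum. *)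
Lemma abs_ln_ratio_summable x :
  bounded_sums (fun k => `|ln (transition_ratio T x k)|).
Proof.
pose a k := `|transition_ratio T x k - 1|.
have a0 k : 0 <= a k by exact: normr_ge0.
have [S aS] : bounded_sums a.
  have fin : (\sum_(0 <= k <oo) (a k)%:E)%E \is a fin_num.
    rewrite ge0_fin_numE; first exact: T_qs.
    by apply: nneseries_ge0 => k _ _; rewrite lee_fin.
  exists (fine (\sum_(0 <= k <oo) (a k)%:E)%E) => m.
  rewrite -lee_fin fineK// -sumEFin -(big_mkord xpredT (fun k => (a k)%:E)).
  by apply: nneseries_lim_ge => k _; rewrite lee_fin.
have cva : cvgn (series a).
  apply: nondecreasing_is_cvgn.
    by apply: nondecreasing_series => k _ _ /=; exact: normr_ge0.
  by exists S => _ [m _ <-]; rewrite /series /= big_mkord.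
have /cvgrPdist_le /(_ 2^-1) := cvg_series_cvg_0 cva.
rewrite invr_gt0 ltr0n => /(_ isT) [K _ aK].
pose b k := `|ln (transition_ratio T x k)|.
have b0 k : 0 <= b k by exact: normr_ge0.
exists (\sum_(k < K) b k + 2 * S) => m.
apply: (@le_trans _ _ (\sum_(k < m) ((if (k < K)%N then b k else 0) + 2 * a k))).
  apply: ler_sum => k _; case: ltnP => kK; first by rewrite lerDl mulr_ge0.
  rewrite add0r; apply: abs_ln_le.
  have := aK k kK; rewrite /= sub0r normrN /a normr_id => /ler_normlP[+ _].
  by rewrite opprB lerBlDr => h; rewrite -lerBlDl in h; apply: le_trans h; lra.
rewrite big_split /=; apply: lerD; last by rewrite -mulr_sumr ler_wpM2l// aS.
rewrite -big_mkcond /=.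
rewrite -(big_mkord (fun k => k < K)%N b) -(big_mkord xpredT b).
have [mK|Km] := leqP m K.
  rewrite [leRHS](big_cat_nat _ mK)//= -[leLHS]addr0 lerD ?sumr_ge0//.
  by rewrite [leLHS]big_mkcond ler_sum// => k _; case: ifP.
rewrite (big_cat_nat _ (ltnW Km))//= [X in _ + X](_ : _ = 0) ?addr0; last first.
  by rewrite big_nat_cond big1// => k /andP[/andP[+ _]]; rewrite leqNgt => /negbTE ->.
by rewrite [leLHS]big_mkcond ler_sum// => k _; case: ifP.
Qed.

(* Quasi-stationarity along the two words ijij... and jiji... controls the
   entry (i, j) of all matrices at once. *)
Lemma abs_ln_ratio_sums : exists C, forall x m,
  \sum_(k < m) `|ln (transition_ratio T x k)| <= C.
Proof.
pose r k i j := `|ln (T k i j / T k.+1 i j)|.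
have r_bd i j : exists C, forall m, \sum_(k < m) r k i j <= C.
  pose y i' j' : words n := fun k => if odd k then j' else i'.
  have [C1 yC1] := abs_ln_ratio_summable (y i j).
  have [C2 yC2] := abs_ln_ratio_summable (y j i).
  exists (C1 + C2) => m.
  (* The word [y i j] passes from [i] to [j] at even positions and [y j i] does so at odd ones, so
     together they meet [r k i j] for every [k]. *)
  apply: le_trans (lerD (yC1 m) (yC2 m)); rewrite -big_split ler_sum//= => k _.
  rewrite /r /transition_ratio /letter /y /=.
  by case: odd => /=; rewrite ?lerDl ?lerDr normr_ge0.
have /choice[C rC] : forall p, exists C, forall m, \sum_(k < m) r k p.1 p.2 <= C.
  by move=> p; exact: r_bd.
(* Each transition of [x] is one of the finitely many pairs [p], so the sum over all pairs gives a
   bound that is uniform in [x]. *)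
exists (\sum_p C p) => x m.
apply: (@le_trans _ _ (\sum_p \sum_(k < m) r k p.1 p.2)); last exact: ler_sum.
rewrite exchange_big ler_sum//= => k _; rewrite (bigD1 (x k, x k.+1))//= lerDl.
by rewrite sumr_ge0// => p _; exact: normr_ge0.
Qed.

Lemma ratio_productE x m :
  ratio_product T x m = expR (\sum_(k < m) ln (transition_ratio T x k)).
Proof.
rewrite expR_sum; apply: eq_bigr => k _.
by rewrite lnK// posrE transition_ratio_gt0.
Qed.

(** The exponent is bounded uniformly in the word and in [m]; the resulting constant later serves as
    the dominating function. *)
Lemma ratio_product_bounds : exists2 C, 0 < C & forall x m,
  C^-1 <= ratio_product T x m <= C.
Proof.
have [C rC] := abs_ln_ratio_sums; exists (expR C) => [|x m]; first exact: expR_gt0.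
rewrite ratio_productE -expRN !ler_expR -ler_norml.
exact: le_trans (ler_norm_sum _ _ _) (rC x m).
Qed.

(** The logarithms form an absolutely convergent series, and the exponential is continuous. *)
Lemma ratio_product_cvg x : cvgn (ratio_product T x).
Proof.
pose u k := ln (transition_ratio T x k).
have cu : cvgn (series u).
  apply: normed_cvg; apply: nondecreasing_is_cvgn.
    by apply: nondecreasing_series => k _ _ /=; exact: normr_ge0.
  have [C rC] := abs_ln_ratio_summable x.
  by exists C => _ [m _ <-]; have := rC m; rewrite -(big_mkord xpredT (fun k => `|u k|)).
rewrite (_ : ratio_product T x = expR \o series u); last first.
  by apply/funext => m; rewrite ratio_productE /series /= big_mkord.
apply/cvg_ex; exists (expR (limn (series u))).
exact: (continuous_cvg _ (@continuous_expR R _)).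
Qed.

Lemma markov_F_bounds : exists2 C, 0 < C & forall x, C^-1 <= markov_F T x <= C.
Proof.
have [C C0 rC] := ratio_product_bounds; exists C => // x; apply/andP; split.
  rewrite /markov_F; apply: limr_ge; first exact: ratio_product_cvg.
  by apply: nearW => m; have /andP[] := rC x m.
rewrite /markov_F; apply: limr_le; first exact: ratio_product_cvg.
by apply: nearW => m; have /andP[] := rC x m.
Qed.

Lemma markov_F_gt0 x : 0 < markov_F T x.
Proof.
have [C C0 /(_ x) /andP[FC _]] := markov_F_bounds.
by apply: lt_le_trans FC; rewrite invr_gt0.
Qed.

End RatioProduct.

(** * Densities determined by cylinders *)

Section CylinderDensities.
Context (R : realType) (n : nat).
Variables mu nu : {finite_measure set (words n) -> \bar R}.
Implicit Types (x : words n) (I : seq 'I_n.+1) (g : words n -> R).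

Lemma trivIset_cylinder_rcons I :
  trivIset setT (fun i : 'I_n.+1 => cylinder (rcons I i)).
Proof.
apply/trivIsetP => i j _ _ /eqP ij; apply/seteqP; split=> // x.
by rewrite !cylinder_rcons => -[[_ xi] [_ xj]]; apply: ij; rewrite -xi -xj.
Qed.

Lemma trivIset_cylinder_cons I :
  trivIset setT (fun i : 'I_n.+1 => cylinder (i :: I)).
Proof.
apply/trivIsetP => i j _ _ /eqP ij; apply/seteqP; split=> // x.
by rewrite !cylinder_cons => -[[xi _] [xj _]]; apply: ij; rewrite -xi -xj.
Qed.

Lemma measure_cylinder_split (m : {measure set (words n) -> \bar R}) I :
  m (cylinder I) = (\sum_i m (cylinder (rcons I i)))%E.
Proof.
rewrite {1}cylinder_split measure_bigsetU_ord//; last exact: trivIset_cylinder_rcons.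
by move=> i; exact: measurable_cylinder.
Qed.

Lemma integral_cylinder_split g I : measurable_fun setT g -> (forall x, 0 <= g x) ->
  (\int[mu]_(x in cylinder I) (g x)%:E =
   \sum_i \int[mu]_(x in cylinder (rcons I i)) (g x)%:E)%E.
Proof.
move=> mg g0; rewrite {1}cylinder_split ge0_integral_bigsetU//=.
- by move=> i; exact: measurable_cylinder.
- exact: index_enum_uniq.
- by move=> i j _ _; exact: (@trivIset_cylinder_rcons I i j).
- by apply/measurable_EFinP; exact: measurable_funTS.
- by move=> x _; rewrite lee_fin.
Qed.

(** Both sides are countably additive in [A], so the equality passes from cylinders to all Borel
    sets by [cylinder_induction]. *)
Lemma cylinder_density g : measurable_fun setT g -> (forall x, 0 <= g x) ->
  (forall I, nu (cylinder I) = \int[mu]_(x in cylinder I) (g x)%:E)%E ->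
  forall A, measurable A -> (nu A = \int[mu]_(x in A) (g x)%:E)%E.
Proof.
move=> mg g0 nuE.
have mgE (A : set (words n)) : measurable_fun A (EFin \o g).
  by apply/measurable_EFinP; exact: measurable_funTS.
have nuT : (nu setT = \int[mu]_x (g x)%:E)%E by rewrite -cylinder_nil nuE.
apply: cylinder_induction => [//|A mA nuA|F mF tF nuF].
- have mAC : measurable (~` A) by exact: measurableC.
  have E1 : (nu setT = nu A + nu (~` A))%E.
    by rewrite -(setUCr A) measureU// setICr.
  have E2 : (\int[mu]_x (g x)%:E =
      \int[mu]_(x in A) (g x)%:E + \int[mu]_(x in ~` A) (g x)%:E)%E.
    rewrite -(setUCr A) ge0_integral_setU//; last by apply/disj_setPCl.
    by move=> x _; rewrite lee_fin.
  (* Finiteness of [nu A] allows the equality on [A] to be subtracted from the one on the whole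
     space. *)
  have fA : nu A \is a fin_num by exact: fin_num_measure.
  rewrite -[LHS](addeK _ fA) addeC [X in (_ + X)%E]addeC -E1 nuT E2 -nuA.
  by rewrite [X in (_ + X)%E]addeC addeC addeK.
- rewrite measure_semi_bigcup//; last exact: bigcupT_measurable.
  rewrite ge0_integral_bigcup//; first by apply: eq_eseriesr => k _; exact: nuF.
  by move=> x _; rewrite lee_fin.
Qed.

(* It suffices to compare nu with the approximations g_ m mu on cylinders of
   one length L m >= m: shorter cylinders are finite unions of these. *)
Lemma density_of_approximations (g_ : (words n -> R)^nat) g (L : nat -> nat) C :
  (forall m, m <= L m)%N ->
  (forall m x, 0 <= g_ m x <= C) ->
  (forall m x y, (forall k, k < L m -> x k = y k)%N -> g_ m x = g_ m y) ->
  (forall m x, nu (cylinder (mkseq x (L m))) =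
    (g_ m x)%:E * mu (cylinder (mkseq x (L m))))%E ->
  (forall x, g_ ^~ x @ \oo --> g x) ->
  measurable_fun setT g /\
  forall A, measurable A -> (nu A = \int[mu]_(x in A) (g x)%:E)%E.
Proof.
move=> Lm g_C g_loc nug_ cg.
have mg_ m : measurable_fun setT (g_ m).
  (* [pad] completes a finite word with the letter 0; since [g_ m] reads only the first [L m]
     letters, this tail does not change its value. *)
  pose pad I : words n := fun k => nth ord0 I k.
  rewrite (_ : g_ m = fun x => (g_ m \o pad) (mkseq x (L m))).
    exact: measurable_fun_prefix.
  by apply/funext => x /=; apply: g_loc => k kL; rewrite /letter /pad nth_mkseq.
have mg : measurable_fun setT g.
  by apply: (measurable_fun_cvg mg_) => x _; exact: cg.
have g_0 m x : 0 <= g_ m x by have /andP[] := g_C m x.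
have g0 x : 0 <= g x.
  rewrite -(cvg_lim _ (cg x))//; apply: limr_ge; first by apply/cvg_ex; exists (g x).
  exact: nearW.
(* Induction on the number [k] of letters missing to length [L m]: splitting a cylinder by its next
   letter lowers [k] by one. *)
have nug_le k : forall m I, (size I + k)%N = L m ->
    (nu (cylinder I) = \int[mu]_(x in cylinder I) (g_ m x)%:E)%E.
  elim: k => [|k IH] m I IL.
    rewrite addn0 in IL; pose x : words n := fun k => nth ord0 I k.
    have xI : mkseq x (L m) = I by rewrite -IL; exact: mkseq_nth.
    rewrite -{1}xI nug_ xI -integral_cst; last exact: measurable_cylinder.
    apply: eq_integral => y /[!inE] /cylinderP yI; congr EFin.
    by apply: g_loc => i; rewrite -IL => /yI ->.
  rewrite integral_cylinder_split// [LHS]measure_cylinder_split.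
  by apply: eq_bigr => i _; apply: IH; rewrite size_rcons addSnnS.
split=> //; apply: cylinder_density => // I.
have [| | | | |_ _ cI] := @dominated_convergence _ _ _ mu _ (measurable_cylinder I)
  (fun m => EFin \o g_ m) (EFin \o g) (cst C%:E).
- by move=> m; apply/measurable_EFinP; exact: measurable_funTS.
- by apply/measurable_EFinP; exact: measurable_funTS.
- by apply: aeW => x _; apply: cvg_EFin; [exact: nearW|exact: cg].
- apply: (integrableS measurableT) => //; first exact: measurable_cylinder.
  exact: finite_measure_integrable_cst.
- apply: aeW => x m _ /=; rewrite lee_fin ger0_norm//.
  by have /andP[] := g_C m x.
rewrite -(cvg_lim _ cI)//; apply/esym/cvg_lim => //.
(* As soon as [size I <= m], also [size I <= L m], so the integrals are eventually equal to
   [nu (cylinder I)]. *)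
apply: cvg_near_cst; near=> m => /=.
have mI : (size I <= L m)%N.
  by apply: leq_trans (Lm m); near: m; exact: nbhs_infty_ge.
by rewrite -(nug_le (L m - size I)%N m I)// subnKC.
Unshelve. all: by end_near. Qed.

End CylinderDensities.

(** * Uniqueness of Radon-Nikodym derivatives *)

Section RadonNikodym.
Context d (T : measurableType d) (R : realType).

Lemma dominates_of_density (mu : {measure set T -> \bar R}) (nu : set T -> \bar R)
    (g : T -> \bar R) : measurable_fun setT g ->
  (forall A, measurable A -> nu A = \int[mu]_(x in A) g x)%E -> nu `<< mu.
Proof.
move=> mg nuE; apply/null_content_dominatesP => A mA A0; rewrite nuE//.
by apply: null_set_integral => //; exact: measurable_funTS.
Qed.

Lemma ae_eq_Radon_Nikodym (mu : {sigma_finite_measure set T -> \bar R})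
    (nu : {charge set T -> \bar R}) (g : T -> \bar R) : measurable_fun setT g ->
  (forall A, measurable A -> nu A = \int[mu]_(x in A) g x)%E ->
  {ae mu, forall x, ('d nu '/d mu) x = g x}.
Proof.
move=> mg nuE; have numu := dominates_of_density mg nuE.
have : ae_eq mu setT ('d nu '/d mu) g.
  apply: integral_ae_eq => //; first exact: Radon_Nikodym_integrable.
  by move=> E _ mE; rewrite -nuE// -Radon_Nikodym_integral.
by apply: filterS => x; exact.
Qed.

End RadonNikodym.

(** * The Markov measure under the inverse branches and the shift *)

Section MarkovDensities.
Context (R : realType) (n : nat) (lam : 'rV[R]_n.+1) (T : nat -> 'M[R]_n.+1).
Hypotheses (lam_gt0 : forall i, 0 < lam 0 i) (T_gt0 : forall k i j, 0 < T k i j).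
Variable mu : probability (words n) R.
Hypothesis mu_markov : is_markov_measure lam T mu.
Hypothesis T_qs : quasi_stationary T.
Implicit Types x : words n.

Lemma mkseq_word x m : mkseq x m.+1 = x 0%N :: mkseq (word_shift x) m.
Proof. by rewrite /mkseq /= (iotaDl 1 0 m) -map_comp. Qed.

Lemma markov_mkseq x m : mu (cylinder (mkseq x m.+1)) =
  (lam 0 (x 0%N) * \prod_(k < m) T k (x k) (x k.+1))%:E.
Proof.
rewrite mkseq_word mu_markov -mkseq_word size_mkseq; congr (_ * _)%:E.
by apply: eq_bigr => k _; have km := ltn_ord k; rewrite !nth_mkseq// ltnS ltnW.
Qed.

Let branch_approximation j m x : R :=
  (j == x 0%N)%:R * (lam 0 (x 1%N) / (lam 0 (x 0%N) * T 0%N (x 0%N) (x 1%N))) *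
  ratio_product T (word_shift x) m.

(** The factor of index [k] reads the letters [k] and [k.+1], whence one letter more than there are
    factors. *)
Lemma ratio_product_local m x y :
  (forall k, (k < m.+1)%N -> x k = y k) -> ratio_product T x m = ratio_product T y m.
Proof.
move=> xy; apply: eq_bigr => k _.
have k1 : (k < m.+1)%N by rewrite ltnS ltnW.
by rewrite /transition_ratio (xy k k1) (xy k.+1 (ltn_ord k)).
Qed.

Lemma markov_branch_density j :
  measurable_fun setT (markov_density lam T j) /\
  forall A, measurable A -> (image_measure mu (word_branch j) A =
    \int[mu]_(x in A) (markov_density lam T j x)%:E)%E.
Proof.
have [C C0 rC] := ratio_product_bounds T_gt0 T_qs.
have r0 x m : 0 <= ratio_product T x m.
  by have /andP[+ _] := rC x m; apply: le_trans; rewrite invr_ge0 ltW.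
pose c p := lam 0 p.2 / (lam 0 p.1 * T 0%N p.1 p.2).
have c0 p : 0 <= c p by rewrite ltW// divr_gt0// mulr_gt0.
(* The length is [m.+2] because the product is taken along the shifted word. In the bound, the sum
   of the finitely many [c p] dominates the front factor and [C] dominates the product. *)
apply: (@density_of_approximations _ _ _ _ (branch_approximation j) _
  (fun m => m.+2) ((\sum_p c p) * C)).
- by move=> m; exact: leqW.
- move=> m x; rewrite /branch_approximation -/(c (x 0%N, x 1%N)).
  apply/andP; split; first by rewrite mulr_ge0// mulr_ge0.
  apply: ler_pM => //; [exact: mulr_ge0| |by have /andP[] := rC (word_shift x) m].
  apply: (@le_trans _ _ (c (x 0%N, x 1%N))).
    by rewrite ler_piMl//; case: eqP.
  by rewrite (bigD1 (x 0%N, x 1%N))//= lerDl sumr_ge0.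
- move=> m x y xy; rewrite /branch_approximation !xy//; congr (_ * _).
  by apply: ratio_product_local => k km; exact: xy.
- move=> m x; rewrite [X in (_ * X)%E](markov_mkseq x m.+1) -EFinM /image_measure.
  rewrite /= /pushforward mkseq_word preimage_branch_cylinder /branch_approximation (eq_sym j).
  (* If [x] does not start with [j], the preimage is empty and the Kronecker delta is 0. *)
  case: eqP => _; last by rewrite measure0 !mul0r.
  rewrite [LHS](markov_mkseq (word_shift x) m) mul1r; congr EFin.
  rewrite big_ord_recl /= /ratio_product /transition_ratio prodf_div.
  rewrite /bump /=.
  (* The denominators of the ratios are the transition factors of the long cylinder after its first
     one. They cancel and leave those of the shifted word. *)
  have P0 : \prod_(i < m) T i.+1 (x i.+1) (x i.+2) != 0.
    by apply/prodf_neq0 => k _; rewrite gt_eqF.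
  rewrite (_ : \prod_(i < m) T (1 + i)%N (x (1 + i)%N) (x (1 + i).+1) =
    \prod_(i < m) T i.+1 (x i.+1) (x i.+2))//.
  set a := \prod_(i < m) _; set b := \prod_(i < m) _ in P0 *.
  have L0 : lam 0 (x 0%N) != 0 by rewrite gt_eqF.
  have T0 : T 0%N (x 0%N) (x 1%N) != 0 by rewrite gt_eqF.
  rewrite [word_shift x 0%N](_ : _ = x 1%N)//.
  by field; rewrite P0 L0 T0.
- move=> x; apply: cvgMr; exact: ratio_product_cvg.
Qed.

(** Prepending a letter raises every matrix index by one, so the quotient of the two measures has
    the numerators and denominators of the partial product exchanged. Summing over the prepended
    letter restores the initial weight, by stationarity of [lam]. *)
Lemma markov_shift_density (lam_stationary : lam *m T 0%N = lam) :
  measurable_fun setT (fun x => (markov_F T x)^-1) /\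
  forall A, measurable A -> (image_measure mu (@word_shift n) A =
    \int[mu]_(x in A) ((markov_F T x)^-1)%:E)%E.
Proof.
have [C C0 rC] := ratio_product_bounds T_gt0 T_qs.
have r0 x m : 0 < ratio_product T x m.
  by have /andP[+ _] := rC x m; apply: lt_le_trans; rewrite invr_gt0.
apply: (@density_of_approximations _ _ _ _ (fun m x => (ratio_product T x m)^-1) _
  (fun m => m.+1) C).
- by move=> m; exact: leqnSn.
- move=> m x; rewrite invr_ge0 ltW//=.
  by have /andP[+ _] := rC x m; rewrite invf_ple// posrE.
- by move=> m x y xy; congr (_^-1); exact: ratio_product_local.
- move=> m x; rewrite [X in (_ * X)%E](markov_mkseq x m) -EFinM /image_measure.
  rewrite /= /pushforward preimage_shift_cylinder measure_bigsetU_ord; last 2 first.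
  + by move=> i; exact: measurable_cylinder.
  + exact: trivIset_cylinder_cons.
  have step i : mu (cylinder (i :: mkseq x m.+1)) =
      (lam 0 i * T 0%N i (x 0%N) * \prod_(k < m) T k.+1 (x k) (x k.+1))%:E.
    have -> : i :: mkseq x m.+1 = mkseq (word_branch i x) m.+2 by rewrite [RHS]mkseq_word branchK.
    by rewrite [LHS](markov_mkseq (word_branch i x) m.+1) big_ord_recl mulrA.
  rewrite (eq_bigr _ (fun i _ => step i)).
  rewrite sumEFin -mulr_suml; congr EFin.
  have -> : \sum_i lam 0 i * T 0%N i (x 0%N) = lam 0 (x 0%N).
    by rewrite -[in RHS]lam_stationary mxE.
  rewrite /ratio_product /transition_ratio prodf_div invf_div.
  rewrite mulrCA divfK//.
  by apply/prodf_neq0 => k _; rewrite gt_eqF.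
- move=> x; apply: cvgV; first by rewrite gt_eqF// markov_F_gt0.
  exact: ratio_product_cvg.
Qed.

Lemma markov_density_gt0 j x : x 0%N = j -> 0 < markov_density lam T j x.
Proof.
move=> <-; rewrite /markov_density eqxx mul1r mulr_gt0 ?markov_F_gt0//.
by rewrite divr_gt0// mulr_gt0.
Qed.

Lemma markov_density_eq0 j x : x 0%N != j -> markov_density lam T j x = 0.
Proof. by rewrite eq_sym /markov_density => /negbTE ->; rewrite !mul0r. Qed.

Lemma markov_density_ge0 j x : 0 <= markov_density lam T j x.
Proof.
have [/markov_density_gt0/ltW//|/markov_density_eq0 ->//] := eqVneq (x 0%N) j.
Qed.

End MarkovDensities.

(** * Closed spans and operators in L^2 *)

Section PreHilbert.
Context (C : numClosedFieldType) (H : lmodType C) (ip : {dot H for Num.conj}).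
Implicit Types (A B : H -> H) (u v w : H) (X : set H).

(** The vector picked by [xget] and [B v] have the same inner products with all vectors, so their
    difference is orthogonal to itself and vanishes by definiteness. *)
Lemma is_adjoint_adjoint A B : is_adjoint ip A B -> adjoint ip A = B.
Proof.
move=> AB; apply/funext => v; rewrite /adjoint; case: xgetP => [w wE /= wA|/(_ (B v))[]//].
apply/eqP; rewrite -subr_eq0 -(dnorm_eq0 ip); apply/eqP.
by rewrite linearBr /= -wA AB subrr.
Qed.

Lemma hnorm_lt u (e : C) : 0 < e -> (hnorm ip u < e) = (ip u u < e ^+ 2).
Proof.
move=> e0; have h0 : 0 <= hnorm ip u by exact: sqrt_dnorm_ge0.
by rewrite -[in RHS](sqrtCK (ip u u)) ltr_pXn2r// nnegrE// ltW.
Qed.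

(** From the parallelogram identity. With both tolerances halved, it does the work of the triangle
    inequality in [hnormD_lt]. *)
Lemma dnormD_le u v : ip (u + v) (u + v) <= 2 * (ip u u + ip v v).
Proof.
have <- : ip (u + v) (u + v) + ip (u - v) (u - v) = 2 * (ip u u + ip v v).
  by rewrite dnormD dnormB; ring.
by rewrite lerDl dnorm_ge0.
Qed.

Lemma hnormD_lt u v (e : C) : 0 < e ->
  hnorm ip u < e / 2 -> hnorm ip v < e / 2 -> hnorm ip (u + v) < e.
Proof.
move=> e0; have e2 : 0 < e / 2 by rewrite divr_gt0.
rewrite !hnorm_lt// => ue ve; apply: le_lt_trans (dnormD_le u v) _.
have -> : e ^+ 2 = 2 * ((e / 2) ^+ 2 + (e / 2) ^+ 2) by field.
by rewrite ltr_pM2l// ltrD.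
Qed.

Lemma hnormZ a u : hnorm ip (a *: u) = `|a| * hnorm ip u.
Proof.
apply/eqP; rewrite -(@eqrXn2 _ 2)//; last 2 first.
- exact: sqrt_dnorm_ge0.
- by rewrite mulr_ge0//; exact: sqrt_dnorm_ge0.
by rewrite exprMn !sqrtCK dnormZ.
Qed.

Lemma sub_closed_span X : X `<=` closed_span ip X.
Proof.
move=> u Xu e e0; exists [:: (1, u)]; split=> [p|].
  by rewrite inE => /eqP ->.
by rewrite big_seq1 scale1r subrr /hnorm linear0r sqrtC0.
Qed.

Lemma closed_span_lim X u :
  (forall e : C, 0 < e -> exists2 v, closed_span ip X v & hnorm ip (u - v) < e) ->
  closed_span ip X u.
Proof.
move=> uX e e0; have e2 : 0 < e / 2 by rewrite divr_gt0.
have [v vX uv] := uX _ e2; have [s [sX vs]] := vX _ e2; exists s; split=> //.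
by rewrite -(subrK v u) -addrA; exact: hnormD_lt.
Qed.

Lemma closed_spanD X u v :
  closed_span ip X u -> closed_span ip X v -> closed_span ip X (u + v).
Proof.
move=> uX vX e e0; have e2 : 0 < e / 2 by rewrite divr_gt0.
have [s [sX us]] := uX _ e2; have [t [tX vt]] := vX _ e2.
exists (s ++ t); split=> [p|]; first by rewrite mem_cat => /orP[/sX|/tX].
by rewrite big_cat opprD addrACA; exact: hnormD_lt.
Qed.

Lemma closed_spanZ X a u : closed_span ip X u -> closed_span ip X (a *: u).
Proof.
(* Dividing by [|a| + 1] instead of [|a|] also covers [a = 0]. *)
move=> uX e e0; have a0 : 0 < `|a| + 1 by rewrite ltr_wpDl.
have [|s [sX us]] := uX (e / (`|a| + 1)); first by rewrite divr_gt0.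
exists [seq (a * p.1, p.2) | p <- s]; split=> [_ /mapP[p ps ->]|]; first exact: (sX p ps).
have -> : \sum_(p <- [seq (a * p.1, p.2) | p <- s]) p.1 *: p.2 =
    a *: \sum_(p <- s) p.1 *: p.2.
  by rewrite big_map scaler_sumr; apply: eq_bigr => p _; rewrite -scalerA.
rewrite -scalerBr hnormZ; move: us; rewrite ltr_pdivlMr// mulrC; apply: le_lt_trans.
by rewrite ler_wpM2r ?lerDl//; exact: sqrt_dnorm_ge0.
Qed.

End PreHilbert.

(** * Square integrability in terms of integrals of squares *)

Section SquareIntegrableFunctions.
Context d (T : measurableType d) (R : realType) (mu : {measure set T -> \bar R}).
Implicit Types (g h : T -> R) (f : T -> R[i]).

Lemma Lfun2P g : g \in Lfun mu 2%:E <->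
  measurable_fun setT g /\ (\int[mu]_x (g x ^+ 2)%:E < +oo)%E.
Proof.
split=> [gL|[mg g2]].
  split; first by move: gL; rewrite inE => /andP[/[!inE]].
  have /integrableP[_] := Lfun2_integrable_sqr gL.
  by under eq_integral do rewrite /= ger0_norm ?sqr_ge0//.
rewrite inE; apply/andP; split; rewrite inE//= /finite_norm unlock /Lnorm.
apply: poweR_lty; apply: le_lt_trans g2.
by under eq_integral do rewrite /= powR_mulrn ?normr_ge0// real_normK ?num_real//.
Qed.

Lemma square_integrableP f : f \in square_integrable mu <->
  [/\ measurable_fun setT (@complex.Re R \o f),
      measurable_fun setT (@complex.Im R \o f) &
      (\int[mu]_x (complex.Re (f x) ^+ 2 + complex.Im (f x) ^+ 2)%:E < +oo)%E].
Proof.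
have sq g : measurable_fun setT g -> measurable_fun setT (fun x => (g x ^+ 2)%:E).
  by move=> mg; apply/measurable_EFinP; exact: measurable_funX.
have sumE (mr : measurable_fun setT (@complex.Re R \o f))
    (mi : measurable_fun setT (@complex.Im R \o f)) :
    (\int[mu]_x (complex.Re (f x) ^+ 2 + complex.Im (f x) ^+ 2)%:E =
     \int[mu]_x (complex.Re (f x) ^+ 2)%:E + \int[mu]_x (complex.Im (f x) ^+ 2)%:E)%E.
  rewrite -ge0_integralD//.
  - by move=> x _; rewrite lee_fin sqr_ge0.
  - exact: (sq (@complex.Re R \o f)).
  - by move=> x _; rewrite lee_fin sqr_ge0.
  - exact: (sq (@complex.Im R \o f)).
have i0 g : (0 <= \int[mu]_x (g x ^+ 2)%:E)%E.
  by apply: integral_ge0 => x _; rewrite lee_fin sqr_ge0.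
rewrite inE /=; split=> [/andP[/Lfun2P[mr r2] /Lfun2P[mi i2]]|[mr mi fin]].
  by split=> //; rewrite sumE// lte_add_pinfty.
rewrite sumE// in fin.
apply/andP; split; apply/Lfun2P; split=> //; apply: le_lt_trans fin.
- by rewrite leeDl//; exact: (i0 (@complex.Im R \o f)).
- by rewrite leeDr//; exact: (i0 (@complex.Re R \o f)).
Qed.

Lemma L2norm_class (g : L2fun mu) : L2dot (L2class g) (L2class g) =
  (fine (\int[mu]_x (complex.Re (g x) ^+ 2 + complex.Im (g x) ^+ 2)%:E))%:C%C.
Proof.
rewrite L2dot_class /L2inner /Cintegral; apply/eqP; rewrite eq_complex /=.
apply/andP; split; apply/eqP.
  apply: eq_Rintegral => x _.
  by case: (g x) => p q /=; rewrite mulrN opprK.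
transitivity (\int[mu]_x (0 : R)); last by rewrite /Rintegral integral0.
apply: eq_Rintegral => x _.
by case: (g x) => p q /=; rewrite mulrN mulrC addNr.
Qed.

Lemma Lfun2_real g : g \in Lfun mu 2%:E ->
  (fun x => (g x)%:C%C) \in square_integrable mu.
Proof.
move=> gL; rewrite inE /=; apply/andP; split=> //.
rewrite (_ : _ \o _ = 0); first exact: (@Lfun_addr_closed _ _ _ mu 2%:E (lee1n 2)).1.
by apply/funext.
Qed.

End SquareIntegrableFunctions.

(* The operator g |-> c * (g \o phi) on L^2(mu). The bound says that it is a
   contraction; it also makes the operator well defined on classes, as it
   forces c = 0 almost everywhere on the preimage of a null set. *)
Section WeightedComposition.
Context d (T : measurableType d) (R : realType) (mu : {measure set T -> \bar R}).
Variables (c : T -> R) (phi : T -> T).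
Hypotheses (mc : measurable_fun setT c) (mphi : measurable_fun setT phi).
Hypothesis bound : forall h : T -> \bar R, measurable_fun setT h ->
  (forall x, 0 <= h x)%E ->
  (\int[mu]_x ((c x ^+ 2)%:E * h (phi x)) <= \int[mu]_x h x)%E.
Implicit Types f g : L2fun mu.

Lemma wcomp_square_integrable f :
  (fun x => (c x)%:C%C * f (phi x)) \in square_integrable mu.
Proof.
have /square_integrableP[mr mi fin] := L2fun_proof f.
have reE : @complex.Re R \o (fun x => (c x)%:C%C * f (phi x)) =
    c \* ((@complex.Re R \o f) \o phi).
  by apply/funext => x /=; case: (f (phi x)) => p q /=; rewrite mul0r subr0.
have imE : @complex.Im R \o (fun x => (c x)%:C%C * f (phi x)) =
    c \* ((@complex.Im R \o f) \o phi).
  by apply/funext => x /=; case: (f (phi x)) => p q /=; rewrite mul0r addr0.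
have mre := measurableT_comp mr mphi; have mim := measurableT_comp mi mphi.
apply/square_integrableP; rewrite reE imE; split.
- exact: measurable_funM.
- exact: measurable_funM.
pose h x := (complex.Re (f x) ^+ 2 + complex.Im (f x) ^+ 2)%:E.
have mh : measurable_fun setT h.
  apply/measurable_EFinP; apply: measurable_funD.
    exact: (measurable_funX 2 mr).
  exact: (measurable_funX 2 mi).
have h0 x : (0 <= h x)%E by rewrite lee_fin addr_ge0 ?sqr_ge0.
apply: le_lt_trans fin; apply: le_trans (bound mh h0).
rewrite le_eqVlt; apply/orP; left; apply/eqP/eq_integral => x _.
rewrite /h -EFinM; congr EFin.
by case: (f (phi x)) => p q /=; rewrite !mul0r subr0 addr0 !exprMn mulrDr.
Qed.

Definition wcomp_fun f : L2fun mu := MkL2fun (wcomp_square_integrable f).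

Definition wcomp (u : L2 mu) : L2 mu := L2class (wcomp_fun (L2repr u)).

(** Let [N] be a null set containing the exceptions to [P]. For the indicator of [N], [bound] says
    that the integral of [c ^+ 2] over the preimage of [N] is at most [mu N = 0], so [c] vanishes
    almost everywhere there. *)
Lemma wcomp_ae (P : T -> Prop) : {ae mu, forall x, P x} ->
  {ae mu, forall x, c x != 0 -> P (phi x)}.
Proof.
move=> [N [mN N0 PN]].
have mphiN : measurable (phi @^-1` N) by rewrite -[X in measurable X]setTI; exact: mphi.
have m1 (A : set T) : measurable A -> measurable_fun setT (EFin \o \1_A : T -> \bar R).
  by move=> mA; apply/measurable_EFinP; exact: measurable_indic.
have mq : measurable_fun setT (fun x => (c x ^+ 2)%:E * (\1_N (phi x))%:E)%E.
  apply: emeasurable_funM; first by apply/measurable_EFinP; exact: measurable_funX.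
  exact: (m1 _ mphiN).
have q0 x : (0 <= (c x ^+ 2)%:E * (\1_N (phi x))%:E)%E.
  by rewrite -EFinM lee_fin mulr_ge0// sqr_ge0.
have : (\int[mu]_x `|(c x ^+ 2)%:E * (\1_N (phi x))%:E| = 0)%E.
  under eq_integral do rewrite gee0_abs//.
  apply/eqP; rewrite eq_le integral_ge0// andbT.
  apply: le_trans (bound (m1 _ mN) _) _ => [x|]; first by rewrite lee_fin.
  by rewrite integral_indic// setIT N0.
move/(ae_eq_integral_abs mu measurableT mq); apply: filterS => x /(_ Logic.I) /= q cx.
apply: contrapT => nP; have Nx : N (phi x) by exact: PN.
move: q; rewrite indicE mem_set// mule1 => /eqP; rewrite eqe sqrf_eq0.
exact/negP.
Qed.

(** Independence of the representative: where [c] is nonzero [wcomp_ae] applies, and elsewhere both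
    sides are 0. *)
Lemma wcomp_class f : wcomp (L2class f) = L2class (wcomp_fun f).
Proof.
apply/L2classP; apply: filterS (wcomp_ae (L2reprE f)) => x /= fx.
by have [->|/fx ->//] := eqVneq (c x) 0; rewrite !mul0r.
Qed.

Lemma L2repr_wcomp f :
  {ae mu, forall x, L2repr (wcomp (L2class f)) x = (c x)%:C%C * f (phi x)}.
Proof. by rewrite wcomp_class; exact: L2reprE. Qed.

Lemma wcomp_linear : linear wcomp.
Proof.
move=> a u v; rewrite -[u]L2reprK -[v]L2reprK -L2classZ -L2classD !wcomp_class.
rewrite -L2classZ -L2classD; apply/L2classP; apply: aeW => x /=.
by rewrite !fctE /= mulrDr; congr (_ + _); exact: mulrCA.
Qed.

End WeightedComposition.

(** * From indicators to all of L^2 *)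

Section ClosedSpanL2.
Context d (T : measurableType d) (R : realType) (mu : {finite_measure set T -> \bar R}).
Variable X : set (L2 mu).

Import HBNNSimple.

(** Stated for functions rather than classes, so that pointwise identities and pointwise limits can
    be used. *)
Definition closed_span_fun (g : T -> R[i]) : Prop := exists f : L2fun mu,
  (f : T -> R[i]) = g /\ closed_span (@L2dot _ _ _ mu) X (L2class f).

Lemma closed_span_fun_lin a (g h : T -> R[i]) : closed_span_fun g ->
  closed_span_fun h -> closed_span_fun (fun x => a * g x + h x).
Proof.
move=> [g' [<- gX]] [h' [<- hX]]; exists (a *: g' + h').
split; first by [].
by rewrite L2classD L2classZ; apply: (closed_spanD _ hX); exact: (closed_spanZ _ gX).
Qed.

Lemma closed_span_fun_sum (I : Type) (s : seq I) (g : I -> T -> R[i]) :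
  closed_span_fun (fun=> 0) -> (forall i, closed_span_fun (g i)) ->
  closed_span_fun (fun x => \sum_(i <- s) g i x).
Proof.
move=> X0 Xg; elim: s => [|i s IH].
  by rewrite (_ : (fun x => _) = (fun=> 0))//; apply/funext => x; rewrite big_nil.
rewrite (_ : (fun x => _) = (fun x => 1 * g i x + \sum_(j <- s) g j x)).
  exact: closed_span_fun_lin.
by apply/funext => x; rewrite big_cons mul1r.
Qed.

(** Dominated convergence in L^2: the squares of [g - g_ k] tend to 0 pointwise and are bounded by
    the integrable square of [2 * G]. *)
Lemma closed_span_fun_lim (g_ : (T -> R)^nat) (g G : T -> R) :
  (forall k, closed_span_fun (fun x => (g_ k x)%:C%C)) ->
  g \in Lfun mu 2%:E -> G \in Lfun mu 2%:E ->
  (forall k x, `|g_ k x| <= G x) -> (forall x, `|g x| <= G x) ->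
  (forall x, g_ ^~ x @ \oo --> g x) ->
  closed_span_fun (fun x => (g x)%:C%C).
Proof.
move=> Xg_ gL GL g_G gG cg; exists (MkL2fun (Lfun2_real gL)); split=> //.
apply: closed_span_lim => e e0.
(* In the order on complex numbers, [0 < e] forces [e] to be real. *)
have [e' e'0 eE] : exists2 e' : R, 0 < e' & e = e'%:C%C.
  exists (complex.Re e); last by rewrite RRe_real// gtr0_real.
  by move: e0; rewrite ltcE => /andP[].
have [f f_g] := choice Xg_.
have mf k : measurable_fun setT (g_ k).
  have /square_integrableP[+ _ _] := L2fun_proof (f k).
  by rewrite (f_g k).1.
have [mg _] := (Lfun2P _ _).1 gL.
have mh k : measurable_fun setT (fun x => ((g x - g_ k x) ^+ 2)%:E).
  by apply/measurable_EFinP; apply: measurable_funX; exact: measurable_funB.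
have GL2 : (fun x => 2 * G x) \in Lfun mu 2%:E.
  by rewrite (_ : (fun x => _) = 2 \o* G) ?Lfun_scale ?ler1n//; apply/funext => x /=; rewrite mulrC.
have [| | | | |_ _] := @dominated_convergence _ _ _ mu _ measurableT
  (fun k x => ((g x - g_ k x) ^+ 2)%:E) (cst 0%E) (fun x => ((2 * G x) ^+ 2)%:E).
- exact: mh.
- exact: measurable_cst.
- apply: aeW => x _.
  rewrite [X in _ --> X](_ : _ = ((g x - g x) ^+ 2)%:E); last by rewrite subrr expr0n.
  apply: cvg_EFin; first exact: nearW.
  have gg_ : g x - g_ k x @[k --> \oo] --> g x - g x.
    by apply: cvgB; [exact: cvg_cst|exact: cg].
  exact: (cvgM gg_ gg_).
- exact: Lfun2_integrable_sqr.
- apply: aeW => x k _; rewrite /= lee_fin ger0_norm ?sqr_ge0//.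
  rewrite -real_normK ?num_real// ler_sqr ?nnegrE ?normr_ge0//; last first.
    by rewrite mulr_ge0// (le_trans _ (gG x)).
  by rewrite (le_trans (ler_normB _ _))// mulr_natl mulr2n lerD.
rewrite integral0 => /fine_cvgP[_] /cvgr_lt /(_ (e' ^+ 2)).
rewrite exprn_gt0// => /(_ isT) [k _ /(_ k (leqnn k)) /= ek].
exists (L2class (f k)); first by have [] := f_g k.
rewrite hnorm_lt// eE.
have -> : L2class (MkL2fun (Lfun2_real gL)) - L2class (f k) =
    L2class (MkL2fun (Lfun2_real gL) - f k) by rewrite /L2class raddfB.
rewrite -[X in X < _]/(L2dot _ _) L2norm_class -rmorphXn ltcR.
apply: le_lt_trans ek; rewrite le_eqVlt; apply/orP; left; apply/eqP; congr fine.
apply: eq_integral => x _; congr EFin.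
have -> : (MkL2fun (Lfun2_real gL) - f k) x = (g x - g_ k x)%:C%C.
  by rewrite rmorphB; have /= <- := congr1 (@^~ x) (f_g k).1.
by rewrite /= expr0n addr0.
Qed.

Hypothesis X_indic : forall A, measurable A -> closed_span_fun (fun x => (\1_A x)%:C%C).

(** The usual ladder: indicators, simple functions, nonnegative functions as increasing limits of
    these, real functions as differences of positive and negative parts, complex functions from real
    and imaginary parts. *)
Lemma closed_span_indic_full : closed_span (@L2dot _ _ _ mu) X = setT.
Proof.
have X0 : closed_span_fun (fun=> 0).
  rewrite (_ : (fun=> 0) = (fun x => (\1_(@set0 T) x)%:C%C : R[i])).
    by apply: X_indic; exact: measurable0.
  by apply/funext => x; rewrite indic0.
have X_nneg (g : T -> R) : g \in Lfun mu 2%:E -> (forall x, 0 <= g x) ->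
    closed_span_fun (fun x => (g x)%:C%C).
  move=> gL g0; have [mg _] := (Lfun2P _ _).1 gL.
  have meg : measurable_fun setT (EFin \o g) by apply/measurable_EFinP.
  pose h := nnsfun_approx measurableT meg.
  have ch x : h k x @[k --> \oo] --> g x.
    have /fine_cvgP[_] : (h k x)%:E @[k --> \oo] --> (g x)%:E.
      by apply: (@cvg_nnsfun_approx _ _ _ _ measurableT _ meg) => // y _; rewrite lee_fin.
    by [].
  have hg k x : h k x <= g x.
    rewrite -(cvg_lim _ (ch x))//.
    apply: (@nondecreasing_cvgn_le _ (fun m => h m x)); last first.
      by apply/cvg_ex; exists (g x); exact: ch.
    by move=> m p mp; exact/lefP/nd_nnsfun_approx.
  apply: (@closed_span_fun_lim (fun k => h k) g g) => //.
  - move=> k; rewrite (_ : (fun x => _) = fun x =>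
        \sum_(y <- finmap.enum_fset (fset_set (range (h k))))
        (y%:C%C * (\1_(h k @^-1` [set y]) x)%:C%C + 0)).
      apply: closed_span_fun_sum => // y.
      by apply: closed_span_fun_lin; [exact: X_indic|exact: X0].
    apply/funext => x; rewrite fimfunE fsbig_finite//= rmorph_sum.
    by apply: eq_bigr => y _; rewrite addr0 rmorphM.
  - by move=> k x; rewrite ger0_norm.
  - by move=> x; rewrite ger0_norm.
have X_real (g : T -> R) : g \in Lfun mu 2%:E -> closed_span_fun (fun x => (g x)%:C%C).
  move=> gL; have [mg gfin] := (Lfun2P _ _).1 gL.
  have part (p : T -> R) : measurable_fun setT p -> (forall x, 0 <= p x <= `|g x|) ->
      closed_span_fun (fun x => (p x)%:C%C).
    move=> mp pg; apply: X_nneg => [|x]; last by have /andP[] := pg x.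
    apply/Lfun2P; split=> //; apply: le_lt_trans gfin; apply: ge0_le_integral => //.
    - by move=> x _; rewrite lee_fin sqr_ge0.
    - by apply/measurable_EFinP; exact: measurable_funX.
    - by apply/measurable_EFinP; exact: measurable_funX.
    - move=> x _; have /andP[p0 pgx] := pg x.
      by rewrite lee_fin -[leRHS]real_normK ?num_real// ler_sqr ?nnegrE.
  rewrite (_ : (fun x => _) = fun x => -1 * (g^\- x)%:C%C + (g^\+ x)%:C%C).
    apply: closed_span_fun_lin; apply: part.
    - exact: measurable_funrneg.
    - by move=> x; rewrite funrneg_ge0 /funrneg /= ge_max normr_ge0 -normrN ler_norm.
    - exact: measurable_funrpos.
    - by move=> x; rewrite funrpos_ge0 /funrpos /= ge_max normr_ge0 ler_norm.
  apply/funext => x; rewrite mulN1r addrC -rmorphB /=.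
  by have /= <- := congr1 (@^~ x) (funrposBneg g).
apply/seteqP; split=> // u _; rewrite -[u]L2reprK; move: (L2repr u) => f.
have /andP[fr fi] := L2fun_proof f.
have [f' [f'E f'X]] := closed_span_fun_lin ('i%C) (X_real _ fi) (X_real _ fr).
suff -> : f = f' by [].
apply: val_inj; apply/funext => x /=; rewrite f'E /=.
by rewrite [LHS]complexE addrC.
Qed.

End ClosedSpanL2.

Section CylinderDensity.
Context (R : realType) (n : nat) (mu : {finite_measure set (words n) -> \bar R}).
Variable X : set (L2 mu).
Hypothesis X_cylinder : forall I : seq 'I_n.+1,
  closed_span_fun X (fun x : words n => (\1_(cylinder I) x)%:C%C).

(** The sets whose indicator lies in the closed span are closed under complement, as the constant 1
    is in the span, and under countable disjoint union, by dominated convergence. *)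
Lemma closed_span_cylinder_full : closed_span (@L2dot _ _ _ mu) X = setT.
Proof.
have L1 (A : set (words n)) : measurable A -> (\1_A : words n -> R) \in Lfun mu 2%:E.
  move=> mA; apply/Lfun2P; split; first exact: measurable_indic.
  rewrite (eq_integral (EFin \o \1_A)) => [|x _]; last first.
    by rewrite /= indicE; case: (_ \in _); rewrite ?expr1n ?expr0n.
  rewrite integral_indic// setIT ltey_eq fin_num_measure//.
have XT : closed_span_fun X (fun=> 1).
  rewrite (_ : (fun=> 1) = fun x : words n => (\1_(cylinder [::]) x)%:C%C : R[i]).
    exact: X_cylinder.
  by apply/funext => x; rewrite cylinder_nil indicT.
have X0 : closed_span_fun X (fun=> 0).
  rewrite (_ : (fun=> 0) = fun=> -1 * 1 + 1 : R[i]); first exact: (closed_span_fun_lin (-1) XT XT).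
  by apply/funext => x; rewrite mulr1 addNr.
apply: closed_span_indic_full.
apply: cylinder_induction => [//|A mA XA|F mF tF XF].
  rewrite (_ : (fun x => _) = fun x => -1 * (\1_A x)%:C%C + 1).
    exact: (closed_span_fun_lin (-1) XA XT).
  apply/funext => x; rewrite mulN1r !indicE in_setC.
  by case: (x \in A); rewrite /= ?addNr ?oppr0 ?add0r.
(* By disjointness at most one term is nonzero, so the partial sums are dominated by 1 and are
   eventually constant at each point. *)
have sumE k x : \sum_(i < k) \1_(F i) x =
    if pselect (exists2 i, (i < k)%N & F i x) then 1 else 0 :> R.
  case: pselect => [[i ik Fix]|nF]; last first.
    by rewrite big1// => i _; rewrite indicE memNset// => Fix; apply: nF; exists (i : nat).
  rewrite (bigD1 (Ordinal ik))//= indicE mem_set// big1 ?addr0// => j ji.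
  rewrite indicE memNset// => Fjx; move/eqP: ji; apply; apply: val_inj => /=.
  by apply: (tF j i) => //; exists x.
apply: (@closed_span_fun_lim _ _ _ mu X (fun k x => \sum_(i < k) \1_(F i) x) _ (cst 1)).
- move=> k; rewrite (_ : (fun x => _) = fun x => \sum_(i < k) (\1_(F i) x)%:C%C).
    by apply: closed_span_fun_sum.
  by apply/funext => x; rewrite rmorph_sum.
- by apply: L1; exact: bigcupT_measurable.
- exact: Lfun_cst.
- by move=> k x; rewrite sumE; case: pselect => e; rewrite ?normr1 ?normr0.
- by move=> x; rewrite indicE; case: (_ \in _); rewrite ?normr1 ?normr0.
- move=> x; apply: cvg_near_cst.
  have [[i _ Fix]|nF] := pselect ((\bigcup_i F i) x).
    near=> k; rewrite sumE; case: pselect => [e|[]].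
      by rewrite indicE mem_set//; exists i.
    by exists i => //; near: k; exact: nbhs_infty_gt.
  near=> k; rewrite sumE; case: pselect => [[i ik Fix]|e]; first by case: nF; exists i.
  by rewrite indicE memNset.
Unshelve. all: by end_near. Qed.

End CylinderDensity.

(** * Change of variables along a map with known density *)

Section ChangeOfVariables.
Context (R : realType) (n : nat) (mu : {finite_measure set (words n) -> \bar R}).
Variables (phi : {mfun words n >-> words n}) (g : words n -> R).
Hypotheses (mg : measurable_fun setT g) (g0 : forall x, 0 <= g x).
Hypothesis gE : forall A, measurable A ->
  (image_measure mu phi A = \int[mu]_(x in A) (g x)%:E)%E.

(** The left side is the integral of [h] against the image measure, hence that of [h] times the
    Radon-Nikodym derivative, which agrees with [g] almost everywhere. *)
Lemma ge0_change_of_variables (h : words n -> \bar R) :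
  measurable_fun setT h -> (forall x, 0 <= h x)%E ->
  (\int[mu]_x h (phi x) = \int[mu]_x (h x * (g x)%:E))%E.
Proof.
move=> mh h0; have meg : measurable_fun setT (EFin \o g) by apply/measurable_EFinP.
have numu : image_measure mu phi `<< mu by exact: dominates_of_density meg gE.
transitivity (\int[image_measure mu phi]_x h x)%E.
  by rewrite ge0_integral_pushforward.
rewrite -(Radon_Nikodym_SigmaFinite.change_of_variables numu)//.
have mRN := measurable_int _ (Radon_Nikodym_SigmaFinite.f_integrable numu).
apply: ge0_ae_eq_integral => //.
- exact: emeasurable_funM.
- exact: emeasurable_funM.
- by move=> x _; rewrite mule_ge0// Radon_Nikodym_SigmaFinite.f_ge0.
- by move=> x _; rewrite mule_ge0// lee_fin.
apply: ae_eqe_mul2l; apply: integral_ae_eq => //.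
  exact: Radon_Nikodym_SigmaFinite.f_integrable.
by move=> E _ mE; rewrite -Radon_Nikodym_SigmaFinite.f_integral//; exact: gE.
Qed.

(** As [g] is nonnegative, multiplication by it commutes with taking positive and negative parts,
    and the nonnegative case applies to each part. *)
Lemma Rintegral_change_of_variables (h : words n -> R) : measurable_fun setT h ->
  \int[mu]_x h (phi x) = \int[mu]_x (h x * g x).
Proof.
move=> mh; rewrite /Rintegral; congr fine.
have meh : measurable_fun setT (EFin \o h) by apply/measurable_EFinP.
have posE : (fun x => (h x * g x)%:E)^\+%E = (fun x => (EFin \o h)^\+ x * (g x)%:E)%E.
  by apply/funext => x; rewrite !funeposE /= -!EFin_max -EFinM maxr_pMl// mul0r.
have negE : (fun x => (h x * g x)%:E)^\-%E = (fun x => (EFin \o h)^\- x * (g x)%:E)%E.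
  by apply/funext => x; rewrite !funenegE /= -!EFin_max -EFinM maxr_pMl// mul0r mulNr.
rewrite integralE [RHS]integralE posE negE -!ge0_change_of_variables//.
- by congr (_ - _)%E; apply: eq_integral => x _; rewrite ?funeposE ?funenegE.
- exact: measurable_funeneg.
- exact: measurable_funepos.
Qed.

End ChangeOfVariables.

Section WordAdjoint.
Context (C : numClosedFieldType) (H : lmodType C) (ip : {dot H for Num.conj}).
Variables (n : nat) (S B : 'I_n -> H -> H).

(** Adjoints reverse products: [B] of the first letter acts first, which is the order of [foldl]. *)
Lemma word_operator_adjoint : (forall i, is_adjoint ip (S i) (B i)) ->
  forall I, is_adjoint ip (word_operator S I) (fun v => foldl (fun v i => B i v) v I).
Proof.
move=> SB; elim=> [|i I IH] u v; first by [].
by rewrite [LHS]SB [LHS]IH.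
Qed.

End WordAdjoint.

(** * The representation of the Cuntz algebra *)

Section MonicRepresentation.
Context (R : realType) (n : nat) (mu : {finite_measure set (words n) -> \bar R}).
Variable dens : 'I_n.+1 -> words n -> R.
Hypothesis mdens : forall j, measurable_fun setT (dens j).
Hypothesis dens_gt0 : forall j x, x 0%N = j -> 0 < dens j x.
Hypothesis dens_eq0 : forall j x, x 0%N != j -> dens j x = 0.
Hypothesis densE : forall j A, measurable A ->
  (image_measure mu (word_branch j) A = \int[mu]_(x in A) (dens j x)%:E)%E.
Implicit Types (i j : 'I_n.+1) (x : words n) (f g h : L2fun mu).

Let w j x := Num.sqrt (dens j x).

Let dens_ge0 j x : 0 <= dens j x.
Proof.
by have [/dens_gt0/ltW//|/dens_eq0 ->//] := eqVneq (x 0%N) j.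
Qed.

Let w_sqr j x : w j x ^+ 2 = dens j x.
Proof. by rewrite sqr_sqrtr. Qed.

Let w_gt0 j x : x 0%N = j -> 0 < w j x.
Proof. by move=> xj; rewrite sqrtr_gt0 dens_gt0. Qed.

Let w_eq0 j x : x 0%N != j -> w j x = 0.
Proof. by move=> xj; rewrite /w dens_eq0// sqrtr0. Qed.

Let w_branch j x : w j (word_branch j x) != 0.
Proof. by rewrite gt_eqF// w_gt0. Qed.

Let mw j : measurable_fun setT (w j).
Proof.
apply: measurableT_comp => //.
apply: continuous_measurable_fun; exact: sqrt_continuous.
Qed.

Let mwV j : measurable_fun setT (fun x => (w j x)^-1).
Proof.
rewrite (_ : (fun x => _) = @powR R ^~ (-1) \o w j).
  by apply: measurableT_comp => //; exact: measurable_powR.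
by apply/funext => x /=; rewrite powR_inv1// sqrtr_ge0.
Qed.

Let mwVb j : measurable_fun setT (fun x => (w j (word_branch j x))^-1).
Proof. exact: (measurableT_comp (mwV j) (measurable_branch j)). Qed.

(** Equality holds: it is the change of variables for [h \o word_shift], since the shift undoes the
    branch. *)
Let isometry_bound j (h : words n -> \bar R) : measurable_fun setT h ->
  (forall x, 0 <= h x)%E ->
  (\int[mu]_x ((w j x ^+ 2)%:E * h (word_shift x)) <= \int[mu]_x h x)%E.
Proof.
move=> mh h0; have mhs := measurableT_comp mh (@measurable_shift n).
have := ge0_change_of_variables (mdens j) (dens_ge0 j) (@densE j) mhs (fun x => h0 _).
move=> E; rewrite le_eqVlt; apply/orP; left; apply/eqP.
transitivity (\int[mu]_x ((h \o @word_shift n) x * (dens j x)%:E))%E.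
  by apply: eq_integral => x _; rewrite w_sqr muleC.
rewrite -E; apply: eq_integral => x _ /=.
by rewrite branchK.
Qed.

(** After the change of variables the squared inverse weight cancels [dens j], which leaves the
    integral of [h] over the words that start with [j]. *)
Let coisometry_bound j (h : words n -> \bar R) : measurable_fun setT h ->
  (forall x, 0 <= h x)%E ->
  (\int[mu]_x (((w j (word_branch j x))^-1 ^+ 2)%:E * h (word_branch j x)) <=
   \int[mu]_x h x)%E.
Proof.
move=> mh h0; pose k x := (((w j x)^-1 ^+ 2)%:E * h x)%E.
have mk : measurable_fun setT k.
  by apply: emeasurable_funM => //; apply/measurable_EFinP; exact: measurable_funX.
have k0 x : (0 <= k x)%E by rewrite mule_ge0// lee_fin sqr_ge0.
rewrite (ge0_change_of_variables (mdens j) (dens_ge0 j) (@densE j) mk k0).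
apply: ge0_le_integral => //.
- by move=> x _; rewrite mule_ge0// lee_fin.
- by apply: emeasurable_funM => //; apply/measurable_EFinP.
move=> x _; have [xj|xj] := eqVneq (x 0%N) j; last by rewrite dens_eq0// mule0.
rewrite /k muleAC -EFinM -w_sqr exprVn mulVf ?mul1e// sqrf_eq0.
by rewrite gt_eqF// w_gt0.
Qed.

(** Makes multiplication by the indicator of a cylinder a weighted composition along the
    identity. *)
Let cutoff_bound I (h : words n -> \bar R) : measurable_fun setT h ->
  (forall x, 0 <= h x)%E ->
  (\int[mu]_x (((\1_(cylinder I) x : R) ^+ 2)%:E * h (id x)) <= \int[mu]_x h x)%E.
Proof.
move=> mh h0; have mI : measurable (cylinder I) by exact: measurable_cylinder.
apply: ge0_le_integral => //.
- by move=> x _; rewrite mule_ge0// lee_fin sqr_ge0.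
- apply: emeasurable_funM => //; apply/measurable_EFinP; apply: measurable_funX.
  exact: measurable_indic.
- move=> x _; rewrite indicE; case: (_ \in _); first by rewrite expr1n mul1e.
  by rewrite expr0n mul0e.
Qed.

Let m1 I : measurable_fun setT (\1_(cylinder I) : words n -> R).
Proof. by apply: measurable_indic; exact: measurable_cylinder. Qed.

(** Square integrability holds because the integral of [dens j] is the total mass of the image
    measure, which is finite. *)
Lemma monic_system_of_density :
  monic_system mu (fun j x => (Num.sqrt (dens j x))%:C%C).
Proof.
have medens j : measurable_fun setT (EFin \o dens j) by apply/measurable_EFinP.
split=> j.
- apply: Lfun2_real; apply/Lfun2P; split; first exact: mw.
  have -> : (\int[mu]_x (w j x ^+ 2)%:E = image_measure mu (word_branch j) setT)%E.
    by rewrite densE//; apply: eq_integral => x _; rewrite w_sqr.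
  by rewrite ltey_eq fin_num_measure.
- exact: dominates_of_density (medens j) (densE j).
- have := ae_eq_Radon_Nikodym (medens j) (densE j).
  apply: filterS => x ->; congr EFin.
  by rewrite normc_def /= expr0n addr0 sqrtr_sqr ger0_norm ?sqrtr_ge0// w_sqr.
- apply: aeW => x; rewrite range_branch => /= xj.
  by rewrite eq_complex /= negb_and gt_eqF// w_gt0.
Qed.

Lemma nonnegative_system_of_density :
  nonnegative_system mu (fun j x => (Num.sqrt (dens j x))%:C%C).
Proof. by move=> j; apply: aeW => x; rewrite ler0c sqrtr_ge0. Qed.

Definition monic_S j : L2 mu -> L2 mu :=
  wcomp (mw j) (@measurable_shift n) (@isometry_bound j).

Definition monic_B j : L2 mu -> L2 mu :=
  wcomp (mwVb j) (measurable_branch j) (@coisometry_bound j).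

Let Sfun j := wcomp_fun (mw j) (@measurable_shift n) (@isometry_bound j).
Let Bfun j := wcomp_fun (mwVb j) (measurable_branch j) (@coisometry_bound j).
Let cut I := wcomp_fun (m1 I) (@measurable_id _ _ setT) (@cutoff_bound I).

Let SfunE j f x : Sfun j f x = (w j x)%:C%C * f (word_shift x). Proof. by []. Qed.

Let BfunE j f x :
  Bfun j f x = (w j (word_branch j x))^-1%:C%C * f (word_branch j x).
Proof. by []. Qed.

Let cutE I f x : cut I f x = (\1_(cylinder I) x)%:C%C * f x. Proof. by []. Qed.

Let S_class j f : monic_S j (L2class f) = L2class (Sfun j f).
Proof. exact: wcomp_class. Qed.

Let B_class j f : monic_B j (L2class f) = L2class (Bfun j f).
Proof. exact: wcomp_class. Qed.

Let eq_L2class f g : (forall x, f x = g x) -> L2class f = L2class g.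
Proof. by move=> fg; apply/L2classP; exact: aeW. Qed.

Lemma monic_S_associated :
  associated_representation (fun j x => (Num.sqrt (dens j x))%:C%C) monic_S.
Proof. by move=> j g; exact: L2repr_wcomp. Qed.

(* With r + 'i s = (S_j g) h^* / dens_j, the change of variables by
   word_branch j turns the inner product of g and B_j h into that of S_j g
   and h. *)
Lemma monic_S_adjoint j : is_adjoint (@L2dot _ _ _ mu) (monic_S j) (monic_B j).
Proof.
move=> u v; rewrite -[u]L2reprK -[v]L2reprK; move: (L2repr u) (L2repr v) => {u v} g h.
have /square_integrableP[mgr mgi _] := L2fun_proof g.
have /square_integrableP[mhr mhi _] := L2fun_proof h.
have mgsr := measurableT_comp mgr (@measurable_shift n).
have mgsi := measurableT_comp mgi (@measurable_shift n).
rewrite S_class B_class.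
transitivity (L2inner (Sfun j g) h); first exact: L2dot_class.
transitivity (L2inner g (Bfun j h)); last exact/esym/L2dot_class.
pose r x := (w j x)^-1 * (complex.Re (g (word_shift x)) * complex.Re (h x) +
                          complex.Im (g (word_shift x)) * complex.Im (h x)).
pose s x := (w j x)^-1 * (complex.Im (g (word_shift x)) * complex.Re (h x) -
                          complex.Re (g (word_shift x)) * complex.Im (h x)).
have mr : measurable_fun setT r.
  by apply: measurable_funM => //; apply: measurable_funD; exact: measurable_funM.
have ms : measurable_fun setT s.
  by apply: measurable_funM => //; apply: measurable_funB; exact: measurable_funM.
(* On words starting with [j] this is [dens j = w j ^+ 2]; on the others both sides are 0. *)
have wV x (y : R) : (w j x)^-1 * y * dens j x = w j x * y.
  have [xj|xj] := eqVneq (x 0%N) j; last by rewrite w_eq0// dens_eq0// mulr0 mul0r.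
  by rewrite -w_sqr; field; rewrite gt_eqF// w_gt0.
have CV := Rintegral_change_of_variables (mdens j) (dens_ge0 j) (@densE j).
rewrite /L2inner /Cintegral; congr Complex.
- transitivity (\int[mu]_x (r x * dens j x)).
    apply: eq_Rintegral => x _; rewrite wV SfunE.
    by case: (g _) (h x) => [a b] [a' b'] /=; ring.
  rewrite -CV//; apply: eq_Rintegral => x _; rewrite BfunE /r branchK.
  by case: (g x) (h _) => [a b] [a' b'] /=; ring.
- transitivity (\int[mu]_x (s x * dens j x)).
    apply: eq_Rintegral => x _; rewrite wV SfunE.
    by case: (g _) (h x) => [a b] [a' b'] /=; ring.
  rewrite -CV//; apply: eq_Rintegral => x _; rewrite BfunE /s branchK.
  by case: (g x) (h _) => [a b] [a' b'] /=; ring.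
Qed.

(** A word [word_branch i x] starts with [i], so [w j] vanishes there unless [i = j], in which case
    the weights cancel. *)
Lemma monic_BS i j u : monic_B i (monic_S j u) = (i == j)%:R *: u.
Proof.
rewrite -[u]L2reprK; move: (L2repr u) => {u} g.
rewrite S_class B_class -L2classZ; apply: eq_L2class => x.
rewrite BfunE SfunE branchK mulrA -rmorphM /=.
have [->|ij] := eqVneq i j; first by rewrite mulVf ?w_branch// scale1r mul1r.
by rewrite (@w_eq0 j)//= mulr0 mul0r scale0r.
Qed.

(** At each [x] only the summand of the first letter of [x] survives, and there the two weights
    cancel. *)
Lemma monic_SB_sum u : \sum_i monic_S i (monic_B i u) = u.
Proof.
rewrite -[u]L2reprK; move: (L2repr u) => {u} g.
under eq_bigr do rewrite B_class S_class.
have L0 : L2class 0 = 0 :> L2 mu by rewrite /L2class raddf0.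
rewrite -(big_morph _ (@L2classD _ _ _ mu) L0); apply: eq_L2class => x.
rewrite (big_morph (fun f : L2fun mu => f x) (id1 := 0) (op1 := +%R))//.
rewrite (bigD1 (x 0%N))// big1 => [|i xi].
  rewrite [LHS]addr0 SfunE BfunE shiftK// mulrA -rmorphM /= mulfV ?mul1r//.
  by rewrite gt_eqF// w_gt0.
by rewrite SfunE w_eq0 1?eq_sym// mul0r.
Qed.

Lemma monic_S_cuntz : cuntz_representation (@L2dot _ _ _ mu) monic_S.
Proof.
have adjE i := is_adjoint_adjoint (@monic_S_adjoint i).
split=> [i|i|i j u|u].
- split; first exact: wcomp_linear.
  (* The constant 1 works because each operator is an isometry: moving it across the inner product
     gives [monic_B i (monic_S i u) = u]. *)
  exists 1 => u; rewrite mul1r /hnorm.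
  by rewrite [X in sqrtC X]monic_S_adjoint monic_BS eqxx scale1r.
- by exists (monic_B i); exact: monic_S_adjoint.
- by rewrite adjE monic_BS.
- by under eq_bigr do rewrite adjE; rewrite monic_SB_sum.
Qed.

(* S_I S_I^* is multiplication by the indicator of the cylinder of I. *)
Lemma monic_S_word I g :
  word_operator monic_S I (foldl (fun v i => monic_B i v) (L2class g) I) = L2class (cut I g).
Proof.
(* The function [g] varies in the induction because the hypothesis is applied to [Bfun i g]. *)
elim: I g => [|i I IH] g.
  by apply: eq_L2class => x; rewrite cutE cylinder_nil indicT mul1r.
rewrite [foldl _ _ _]/= B_class [LHS]/= IH S_class; apply: eq_L2class => x.
rewrite SfunE !cutE BfunE cylinder_cons !indicE in_setI.
have [xi|xi] := eqVneq (x 0%N) i.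
  rewrite (mem_set (_ : [set x | x 0%N = i] x))//= shiftK// mulrCA; congr (_ * _).
  by rewrite mulrA -rmorphM /= mulfV ?mul1r// gt_eqF// w_gt0.
by rewrite w_eq0// mul0r memNset ?mul0r//=; exact/eqP.
Qed.

Lemma monic_S_monic : monic_representation (@L2dot _ _ _ mu) monic_S.
Proof.
have L1 : (fun x : words n => (cst 1 x)%:C%C) \in square_integrable mu.
  by apply: Lfun2_real; exact: Lfun_cst.
exists (L2class (MkL2fun L1)); apply: closed_span_cylinder_full => I.
exists (cut I (MkL2fun L1)); split.
  by apply/funext => x; rewrite cutE mulr1.
apply: sub_closed_span; exists I; first by [].
by rewrite (is_adjoint_adjoint (word_operator_adjoint monic_S_adjoint I)) monic_S_word.
Qed.

End MonicRepresentation.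

(* Here N = n.+2 and words n.+1 is K_N. *)
Theorem theorem3p5 (R : realType) (n : nat)
    (lam : 'rV[R]_n.+2) (T : nat -> 'M[R]_n.+2)
    (lam_gt0 : forall i, 0 < lam 0 i) (lam_sum : \sum_i lam 0 i = 1)
    (T_stochastic : forall k, stochastic (T k))
    (T_gt0 : forall k i j, 0 < T k i j)
    (lam_stationary : lam *m T 0%N = lam)
    (mu : probability (words n.+1) R)
    (mu_markov : is_markov_measure lam T mu)
    (T_quasi_stationary : quasi_stationary T) :
  (forall j, image_measure mu (word_branch j) `<< mu) /\
  (forall j, {ae mu, forall x,
     ('d (image_measure mu (word_branch j)) '/d mu) x =
       (markov_density lam T j x)%:E}) /\
  (forall j x, markov_density lam T j x = markov_f lam T j x ^+ 2 /\
     0 <= markov_f lam T j x) /\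
  (forall x, cvgn (ratio_product T x) /\ 0 < markov_F T x) /\
  image_measure mu (@word_shift n.+1) `<< mu /\
  {ae mu, forall x,
     ('d (image_measure mu (@word_shift n.+1)) '/d mu) x =
       ((markov_F T x)^-1)%:E} /\
  let f := fun j x => (markov_f lam T j x)%:C%C in
  monic_system mu f /\ nonnegative_system mu f /\
  exists S : 'I_n.+2 -> L2 mu -> L2 mu,
    associated_representation f S /\
    cuntz_representation (@L2dot _ _ _ mu) S /\
    monic_representation (@L2dot _ _ _ mu) S.
Proof.
have mdens j := (markov_branch_density lam_gt0 T_gt0 mu_markov T_quasi_stationary j).1.
have densE j := (markov_branch_density lam_gt0 T_gt0 mu_markov T_quasi_stationary j).2.
have dens_gt0 j x : x 0%N = j -> 0 < markov_density lam T j x.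
  exact: markov_density_gt0.
have dens_eq0 j x : x 0%N != j -> markov_density lam T j x = 0.
  exact: markov_density_eq0.
have dens_ge0 j x : 0 <= markov_density lam T j x by exact: markov_density_ge0.
have [mF FE] := markov_shift_density T_gt0 mu_markov T_quasi_stationary
  lam_stationary.
have meF : measurable_fun setT (fun x => ((markov_F T x)^-1)%:E).
  by apply/measurable_EFinP.
have medens j : measurable_fun setT (fun x => (markov_density lam T j x)%:E).
  by apply/measurable_EFinP; exact: mdens.
split; first by move=> j; exact: dominates_of_density (medens j) (densE j).
split; first by move=> j; exact: ae_eq_Radon_Nikodym (medens j) (densE j).
split; first by move=> j x; rewrite sqr_sqrtr// sqrtr_ge0.
split; first by move=> x; split; [exact: ratio_product_cvg|exact: markov_F_gt0].
split; first exact: dominates_of_density meF FE.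
split; first exact: ae_eq_Radon_Nikodym meF FE.
move=> f; split; first exact: (monic_system_of_density mdens dens_gt0 dens_eq0 densE).
split; first exact: nonnegative_system_of_density.
exists (monic_S mdens dens_gt0 dens_eq0 densE); split; first exact: monic_S_associated.
split; first exact: monic_S_cuntz.
exact: monic_S_monic.
Qed.
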